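(* For a polynomial $f\in\mathbb{Q}[m_1,m_2,\dots]$ and integers $n\ge k\ge0$, let $E_f(n,k):=\frac1{n!}\sum_{\pi\in S_n}f(\pi)\cdot N_{\mathrm{id}_k}(\pi)$. There exist nonzero polynomials $f\in\mathbb{Q}[m_1,m_2,\dots]$ of arbitrarily large degree such that $E_f(n,k)=0$ for all $n\ge k\ge0$. In particular, there exists such a polynomial with degree at most $24$. Here degree means total degree where each variable $m_j$ has degree $j$.
   Context: For $j\ge1$, $m_j:\bigsqcup_{n\ge0}S_n\to\mathbb{Z}_{\ge0}$ is the function giving the number of $j$-cycles of a permutation, and $f(\pi)$ is the value of the polynomial $f$ at $m_1(\pi),m_2(\pi),\dots$. For $\pi\in S_n$ and $k\ge0$, $N_{\mathrm{id}_k}(\pi)$ is the number of index sequences $1\le i_1<\dots<i_k\le n$ with $\pi(i_1)<\dots<\pi(i_k)$ (so $N_{\mathrm{id}_0}(\pi)=1$). *)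

(* Defs.v *)
From HB Require Import structures.
From mathcomp Require Import all_boot all_order all_algebra all_fingroup.
From mathcomp Require Import finmap.
From mathcomp.multinomials Require Import monalg.

Set Implicit Arguments.
Unset Strict Implicit.
Unset Printing Implicit Defensive.

Import GRing.Theory.
Local Open Scope ring_scope.

(* Q[m_1, m_2, ...]: polynomials in countably many variables.  Cycle lengths
   start at 1 and nat at 0, so the variable with index i stands for m_(i+1). *)
Definition cycle_poly := {malg rat[{cmonom nat}]}.

Definition ncycles (n : nat) (s : 'S_n) (j : nat) : nat :=
  #|[set c in porbits s | #|c| == j]|.

Definition cycle_eval (n : nat) (f : cycle_poly) (s : 'S_n) : rat :=
  mmap idfun
    (fun mon : {cmonom nat} =>
       \prod_(i <- finsupp mon) (ncycles s i.+1)%:R ^+ mon i) f.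

Definition mon_wdeg (mon : {cmonom nat}) : nat :=
  (\sum_(i <- finsupp mon) mon i * i.+1)%N.

(* Meaningful for f != 0 only; it takes the junk value 0 at f = 0. *)
Definition wdeg (f : cycle_poly) : nat := (\max_(mon <- msupp f) mon_wdeg mon)%N.

(* N_{id_k}: the occurrences of the increasing pattern of length k in s. *)
Definition Nid (k n : nat) (s : 'S_n) : nat :=
  #|[set t : k.-tuple 'I_n |
      sorted (fun i j : 'I_n => (i < j)%N) t &&
      sorted (fun i j : 'I_n => (i < j)%N) (map s t)]|.

Definition E (f : cycle_poly) (n k : nat) : rat :=
  (n`!%:R)^-1 * \sum_(s : 'S_n) cycle_eval f s * (Nid k s)%:R.

(* Main.v *)
From HB Require Import structures.
Require Import Defs.
From mathcomp Require Import all_boot all_order all_algebra all_fingroup.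
From mathcomp Require Import finmap ring zify.
From mathcomp.multinomials Require Import monalg.

(** Write p_c for the polynomial c m_c, and replace powers of the m_c by falling
    factorials, so that a monomial p_{c_1} ... p_{c_r} evaluated at a permutation
    counts the r-tuples of points lying on distinct cycles of lengths c_1, ..., c_r.
    The polynomial f is the 4x4 Hankel determinant of (p_{s+i+j}); for s = 2 its
    weighted degree is at most 20.

    The pairing with N_{id_k} is averaged over conjugation: it becomes a sum over
    subsets I of the number of linear orders for which pi restricted to I is
    increasing.  Increasing partial injections match sources to targets first in,
    first out; recursion on the last point of the order shows that this number is 0
    when I contains a nontrivial cycle of pi, and otherwise depends only on n, the
    number of fixed points in I, and the numbers of one-point paths and of longer
    paths of pi restricted to I.  These statistics are local, so recording them by
    variables x, y, z turns each marked c-cycle into the factor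
    w_c = tr M^c - 1 with M = [[y, z], [1, 1]] (the all-in-I cycle is excluded).
    As w is a sum of three geometric sequences, its 4x4 Hankel determinants
    vanish. *)

Set Implicit Arguments.
Unset Strict Implicit.
Unset Printing Implicit Defensive.

Import Order.TTheory GRing.Theory Num.Theory.
Local Open Scope ring_scope.

(** * Counting the linear orders that make a partial injection increasing *)

(* With no queue pending, the number of orders on b fixed points, u one-point
   paths and F longer paths, N points in all, is N ^_ u * base F b L, where
   L = N - u - b counts the points on the longer paths.  With a queue whose
   elements have depths summing to Q the factor base is replaced by
   base + Q * slope (see queue_val). *)
Fixpoint path_coefs (F : nat) : (nat -> int -> int) * (nat -> int -> int) :=
  if F is F'.+1 then
    let A := (path_coefs F').1 in
    let slope b L := A b L + (L - F'%:Z) * (path_coefs F').2 b L in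
    (fix base b L := (F'%:Z * A b (L - 1) + slope b (L - 1)) *+ 2
                       + (if b is b'.+1 then b%:Z * base b' L else 0), slope)
  else (fun b _ => b`!%:Z, fun _ _ => 0).

Definition base F b L := (path_coefs F).1 b L.
Definition slope F b L := (path_coefs F).2 b L.

Lemma base0 b L : base 0 b L = b`!%:Z.
Proof. by []. Qed.

Lemma slope0 b L : slope 0 b L = 0.
Proof. by []. Qed.

Lemma slopeS F b L : slope F.+1 b L = base F b L + (L - F%:Z) * slope F b L.
Proof. by []. Qed.

Lemma baseS F b L : base F.+1 b L =
  (F%:Z * base F b (L - 1) + slope F.+1 b (L - 1)) *+ 2
    + b%:Z * base F.+1 b.-1 L.
Proof. by case: b => [|b]; rewrite /base /slope /= ?mul0r. Qed.

Lemma slope_diff_step F :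
  (forall b L, slope F.+1 b L - slope F.+1 b (L - 1) = F%:Z * slope F b (L - 1)) ->
  (forall b L, base F.+1 b L - base F.+1 b (L - 1) = F%:Z * base F b (L - 1)) ->
  forall b L,
    slope F.+2 b L - slope F.+2 b (L - 1) = F.+1%:Z * slope F.+1 b (L - 1).
Proof.
move=> IHs IHb b L; have e1 := IHb b L; have e2 := IHs b L.
have e3 := slopeS F b (L - 1).
rewrite !(slopeS F.+1) intS.
move: e1 e2 e3; move: (base _ _ _) (base _ _ _) (base _ _ _) (slope _ _ _).
move: (slope _ _ _) (slope _ _ _) => s1 s2 x1 x2 x3 s3 e1 e2 e3.
by lia.
Qed.

Lemma base_diff_step F :
  (forall b L, base F.+1 b L - base F.+1 b (L - 1) = F%:Z * base F b (L - 1)) ->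
  (forall b L,
    slope F.+2 b L - slope F.+2 b (L - 1) = F.+1%:Z * slope F.+1 b (L - 1)) ->
  forall b L,
    base F.+2 b L - base F.+2 b (L - 1) = F.+1%:Z * base F.+1 b (L - 1).
Proof.
move=> IHb IHs.
have eb b L : base F.+1 b L = base F.+1 b (L - 1) + F%:Z * base F b (L - 1).
  by rewrite -IHb addrC subrK.
have es b L : slope F.+2 b L =
    slope F.+2 b (L - 1) + (1 + F%:Z) * slope F.+1 b (L - 1).
  by rewrite -intS -IHs addrC subrK.
elim=> [|b IH] L.
  rewrite [in RHS](baseS F 0) (baseS F.+1 0 L) (baseS F.+1 0 (L - 1)) !mul0r !addr0 intS.
  rewrite (eb 0 (L - 1)) (es 0 (L - 1)) !mulr2n.
  move: (base F.+1 _ _) (base F _ _) (slope F.+2 _ _) (slope F.+1 _ _).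
  by move=> *; ring.
have IH' : base F.+2 b L = base F.+2 b (L - 1) + (1 + F%:Z) * base F.+1 b (L - 1).
  by rewrite -intS -IH addrC subrK.
rewrite [in RHS](baseS F b.+1) (baseS F.+1 b.+1 L) (baseS F.+1 b.+1 (L - 1)).
rewrite [b.+1.-1]/=.
rewrite IH' (eb b.+1 (L - 1)) (es b.+1 (L - 1)) (intS F) !mulr2n.
move: (base F.+2 _ _) (base F.+1 b.+1 _) (base F.+1 b _) (base F _ _).
move: (slope F.+2 _ _) (slope F.+1 _ _).
by move=> *; ring.
Qed.

(** Taking differences in L lowers F by one, and this is what lets [queue_val] satisfy the recursion
    below. The two identities are proved together because [slopeS] involves [base] and [baseS]
    involves [slope]. *)
Lemma slope_base_diff F :
  (forall b L, slope F.+1 b L - slope F.+1 b (L - 1) = F%:Z * slope F b (L - 1))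
  /\ (forall b L, base F.+1 b L - base F.+1 b (L - 1) = F%:Z * base F b (L - 1)).
Proof.
elim: F => [|F [IHs IHb]]; last first.
  have es := slope_diff_step IHs IHb; split=> //; exact: base_diff_step IHb es.
have s1 b L : slope 1 b L = b`!%:Z.
  by rewrite slopeS [base _ _ _]/= [slope 0 _ _]/= mulr0 addr0.
split=> b L; first by rewrite !s1 mul0r subrr.
have b0 : forall b L, base 1 b L = base 1 b 0.
  elim=> [|c IH] K; rewrite baseS [RHS]baseS !s1 ?mul0r //.
  by rewrite [c.+1.-1]/= (IH K).
by rewrite b0 [base 1 b (L - 1)]b0 subrr mul0r.
Qed.

(** * Recursion on the last point of the order *)

Lemma count_permutations_rcons (T : finType) (Y : {set T}) (P : pred (seq T)) :
  Y != set0 ->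
  count P (permutations (enum Y)) =
  (\sum_(z in Y) count (fun s => P (rcons s z)) (permutations (enum (Y :\ z))))%N.
Proof.
move=> Y0.
have /seq.permP -> : perm_eq (permutations (enum Y))
    [seq rcons s z | z <- enum Y, s <- permutations (enum (Y :\ z))].
  apply: uniq_perm; rewrite ?permutations_uniq //.
    apply: allpairs_uniq_dep => [|z _|]; rewrite ?enum_uniq ?permutations_uniq //.
    move=> [z s] [z' s'] _ _ /= E.
    by move: (rcons_inj E) => [-> ->].
  move=> s; rewrite mem_permutations; apply/idP/allpairsPdep => [Es|].
    have us : uniq s by rewrite (perm_uniq Es) enum_uniq.
    have mem x : (x \in s) = (x \in Y) by rewrite (perm_mem Es) mem_enum.
    case/lastP: s us mem Es => [|s z] us mem Es.
      by case/set0Pn: Y0 => x; rewrite -mem.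
    exists z, s; split; rewrite ?mem_enum -?mem ?mem_rcons ?inE ?eqxx //.
    rewrite rcons_uniq in us; case/andP: us => zs us.
    rewrite mem_permutations; apply: uniq_perm; rewrite ?enum_uniq // => x.
    rewrite mem_enum !inE -mem mem_rcons inE.
    by case: (eqVneq x z) => [->|] //=; rewrite (negPf zs).
  case=> z [s' []]; rewrite mem_enum mem_permutations => zY Es ->.
  rewrite perm_rcons; apply: uniq_perm; rewrite ?enum_uniq //=.
    by rewrite (perm_uniq Es) enum_uniq (perm_mem Es) mem_enum !inE eqxx.
  move=> x; rewrite inE (perm_mem Es) !mem_enum !inE.
  by case: eqVneq => [->|].
rewrite count_flatten -!map_comp sumnE big_map big_enum /=.
by apply: eq_bigr => z _; rewrite count_map.
Qed.

Section Queue.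
Context (T : finType).
Implicit Types (p : {perm T}) (I Y : {set T}) (q s : seq T).

(** In the order s, p is increasing on I exactly when these two lists agree: the points of I in
    order, and the preimages of the points of p(I) in order. *)
Definition sources I s := [seq x <- s | x \in I].
Definition targets p I s := [seq (p^-1)%g y | y <- s & (p^-1)%g y \in I].

(* The orders of Y in which p maps sources to targets in the same relative order,
   except that the sources q, whose images were removed from Y, come last. *)
Definition queue_count p I Y q :=
  count (fun s => sources I s == targets p I s ++ q) (permutations (enum Y)).

Lemma sources_rcons I s z :
  sources I (rcons s z) = if z \in I then rcons (sources I s) z else sources I s.
Proof. exact: filter_rcons. Qed.

Lemma targets_rcons p I s z : targets p I (rcons s z) =
  if (p^-1)%g z \in I then rcons (targets p I s) ((p^-1)%g z) else targets p I s.
Proof. by rewrite /targets filter_rcons; case: ifP => // _; rewrite map_rcons. Qed.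

Definition img p I := [set y | (p^-1)%g y \in I].

Lemma sources_img p I s : sources (img p I) s = map p (targets p I s).
Proof.
rewrite /sources /targets -map_comp.
rewrite (eq_map (g := id)); last by move=> y /=; rewrite permKV.
by rewrite map_id; apply: eq_filter => y; rewrite inE.
Qed.

Lemma targets_img p I s : targets p^-1 (img p I) s = map p (sources I s).
Proof.
rewrite /sources /targets invgK; congr map.
by apply: eq_filter => x; rewrite inE permK.
Qed.

(** Mirror symmetry: passing to the inverse of p on p(I) exchanges sources and targets, so targets
    whose sources were removed can again be treated as a queue. *)
Lemma queue_count_img p I Y q :
  queue_count p^-1 (img p I) Y (map p q) =
  count (fun s => targets p I s == sources I s ++ q) (permutations (enum Y)).
Proof.
apply: eq_count => s /=; rewrite sources_img targets_img -map_cat.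
by apply/eqP/eqP => [/(inj_map (@perm_inj _ p))|->].
Qed.

(** A last point in I ends the source list, so it must be the last queue element z0; a last point
    outside I is unrestricted. Its preimage, if in I, has now lost its image and enters the queue at
    the front. *)
Lemma queue_count_rcons p I Y q z0 : (z0 \in Y) -> (z0 \in I) ->
  queue_count p I Y (rcons q z0) =
  (\sum_(z in Y | z \notin I)
      queue_count p I (Y :\ z)
        (if (p^-1)%g z \in I then (p^-1)%g z :: rcons q z0 else rcons q z0)
   + queue_count p I (Y :\ z0)
       (if (p^-1)%g z0 \in I then (p^-1)%g z0 :: q else q))%N.
Proof.
move=> z0Y z0I; rewrite [LHS]count_permutations_rcons; last by apply/set0Pn; exists z0.
rewrite (bigID (mem I)) /= addnC; congr addn.
  apply: eq_bigr => z /andP[_ /negPf zI]; apply: eq_count => s.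
  rewrite sources_rcons targets_rcons zI; case: ifP => // _.
  by rewrite cat_rcons.
rewrite (bigD1 z0) ?z0Y //= big1 => [|z /andP[/andP[_ zI] /negPf nz]].
  rewrite addn0; apply: eq_count => s.
  rewrite sources_rcons targets_rcons z0I.
  by case: ifP => _; rewrite -?cat_rcons -rcons_cat eqseq_rcons eqxx andbT.
apply/eqP; rewrite -leqn0 leqNgt -has_count; apply/hasPn => s _.
rewrite sources_rcons targets_rcons zI.
by case: ifP => _; rewrite -rcons_cat eqseq_rcons nz andbF.
Qed.

(** If the last point z is in I but its preimage is not, then z is a source removed before its
    target, and the mirrored count takes over. If both are in I, both lists end here, which forces z
    to be fixed. *)
Lemma queue_count_nil p I Y : Y != set0 ->
  queue_count p I Y [::] =
  (\sum_(z in Y | z \notin I)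
      queue_count p I (Y :\ z) (if (p^-1)%g z \in I then [:: (p^-1)%g z] else [::])
   + (\sum_(z in Y | (z \in I) && ((p^-1)%g z \notin I))
        queue_count p^-1 (img p I) (Y :\ z) [:: p z]
      + \sum_(z in Y | (z \in I) && (p z == z)) queue_count p I (Y :\ z) [::]))%N.
Proof.
move=> Y0; rewrite [LHS]count_permutations_rcons //.
rewrite (bigID (mem I)) /= addnC; congr addn.
  apply: eq_bigr => z /andP[_ /negPf zI]; apply: eq_count => s.
  rewrite sources_rcons targets_rcons zI; case: ifP => // _.
  by rewrite cats0 cats1.
rewrite (bigID (fun z => (p^-1)%g z \notin I)) /=; congr addn.
  apply: eq_big => [z|z /andP[/andP[_ zI] /negPf z'I]]; first by rewrite andbA.
  rewrite -[[:: p z]]/(map p [:: z]) queue_count_img; apply: eq_count => s.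
  by rewrite sources_rcons targets_rcons zI z'I cats0 cats1 eq_sym.
rewrite [RHS](eq_bigl (fun z => (z \in Y) && (z \in I) && (p z == z))); last first.
  by move=> z; rewrite andbA.
rewrite (bigID (fun z => p z == z)) /= [X in (_ + X)%N]big1 ?addn0.
  apply: eq_big => [z|z /andP[/andP[/andP[_ zI] _] /eqP pz]].
    case: (eqVneq (p z) z) => [pz|]; rewrite ?andbF //= !andbT.
    by rewrite (canLR (permK p) (esym pz)) negbK -andbA andbb.
  apply: eq_count => s; rewrite sources_rcons targets_rcons zI.
  by rewrite (canLR (permK p) (esym pz)) zI !cats0 eqseq_rcons eqxx andbT.
move=> z /andP[/andP[/andP[_ zI]]]; rewrite negbK => z'I pz.
apply/eqP; rewrite -leqn0 leqNgt -has_count; apply/hasPn => s _.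
rewrite sources_rcons targets_rcons zI z'I cats0 eqseq_rcons negb_and.
by apply/orP; right; apply: contra pz => /eqP {1}->; rewrite permKV.
Qed.
End Queue.

(** * The closed form satisfies the recursion *)

Lemma ffactS_split N u : (N.+1 ^_ u = N ^_ u + u * N ^_ u.-1)%N.
Proof.
case: u => [|u]; first by rewrite !ffactn0.
rewrite ffactSS ffactnSr; case: (leqP u N) => uN.
  by rewrite -{1}(subnK uN) -addnS mulnDl (mulnC (N - u)%N).
by rewrite ffact_small // !muln0.
Qed.

Definition queue_val (N u F b : nat) (Q : int) : int :=
  (N ^_ u)%:Z * (base F b (N%:Z - u%:Z - b%:Z) + Q * slope F b (N%:Z - u%:Z - b%:Z)).

(** The summands remove a one-point path, the end of a longer path, and the last queue element. D is
    the total depth of the ends of longer paths: removing an end of depth h adds h - 1 to Q, whence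
    F (Q - 1) + D in total, while removing the last queue element always lowers Q by 1. *)
Lemma queue_val_queue N u F b (Q D : int) :
    N.+1%:Z = b%:Z + Q + (u%:Z + D) -> (F = 0%N -> D = 0) ->
  u%:Z * queue_val N u.-1 F b Q
  + (N ^_ u)%:Z * (F%:Z * base F.-1 b (N%:Z - u%:Z - b%:Z)
                   + (F%:Z * (Q - 1) + D) * slope F.-1 b (N%:Z - u%:Z - b%:Z))
  + queue_val N u F b (Q - 1) = queue_val N.+1 u F b Q.
Proof.
move=> eN D0; rewrite /queue_val.
set L := N.+1%:Z - u%:Z - b%:Z.
have -> : N%:Z - u%:Z - b%:Z = L - 1 by rewrite /L intS; ring.
have -> : u%:Z * ((N ^_ u.-1)%:Z * (base F b (N%:Z - u.-1%:Z - b%:Z) +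
             Q * slope F b (N%:Z - u.-1%:Z - b%:Z))) =
          (u * N ^_ u.-1)%:Z * (base F b L + Q * slope F b L).
  case: u {eN} @L => [|u] /=; first by rewrite !mul0r.
  rewrite (_ : N%:Z - u%:Z - b%:Z = N.+1%:Z - u.+1%:Z - b%:Z) //.
    by rewrite PoszM; ring.
  by rewrite !intS; ring.
rewrite ffactS_split PoszD.
have -> : D = L - Q by rewrite /L eN; ring.
have {D0} : F = 0%N -> L = Q.
  by move=> /D0 e0; rewrite /L eN e0; ring.
move: (N ^_ u)%:Z (u * N ^_ u.-1)%:Z => x y.
case: F => [|F] LQ.
  by rewrite !base0 !slope0 -(LQ erefl); ring.
have [es eb] := slope_base_diff F.
have -> : base F.+1 b L = base F.+1 b (L - 1) + F%:Z * base F b (L - 1).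
  by rewrite -eb addrC subrK.
have -> : slope F.+1 b L = slope F.+1 b (L - 1) + F%:Z * slope F b (L - 1).
  by rewrite -es addrC subrK.
rewrite slopeS [F.+1.-1]/= intS.
move: (base F.+1 _ _) (base F _ _) (slope F _ _) => *; ring.
Qed.

(** The factor 2 arises because a longer path can be opened at its end or, in the mirrored count, at
    its start; both choices contribute depths summing to D - F. The last term removes a fixed
    point. *)
Lemma queue_val_nil N u F b (D : int) :
    N.+1%:Z = b%:Z + (u%:Z + D) -> (F = 0%N -> D = 0) ->
  u%:Z * queue_val N u.-1 F b 0
  + (N ^_ u)%:Z * (F%:Z * base F.-1 b (N%:Z - u%:Z - b%:Z)
                   + (D - F%:Z) * slope F.-1 b (N%:Z - u%:Z - b%:Z)) *+ 2
  + b%:Z * queue_val N u F b.-1 0 = queue_val N.+1 u F b 0.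
Proof.
move=> eN D0; rewrite /queue_val.
set L := N.+1%:Z - u%:Z - b%:Z.
have -> : N%:Z - u%:Z - b%:Z = L - 1 by rewrite /L intS; ring.
have -> : u%:Z * ((N ^_ u.-1)%:Z * (base F b (N%:Z - u.-1%:Z - b%:Z) +
             0 * slope F b (N%:Z - u.-1%:Z - b%:Z))) =
          (u * N ^_ u.-1)%:Z * (base F b L).
  case: u {eN} @L => [|u] /=; first by rewrite !mul0r.
  rewrite (_ : N%:Z - u%:Z - b%:Z = N.+1%:Z - u.+1%:Z - b%:Z) //.
    by rewrite PoszM; ring.
  by rewrite !intS; ring.
have -> : b%:Z * ((N ^_ u)%:Z * (base F b.-1 (N%:Z - u%:Z - b.-1%:Z) +
             0 * slope F b.-1 (N%:Z - u%:Z - b.-1%:Z))) =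
          (N ^_ u)%:Z * (b%:Z * base F b.-1 L).
  case: b {eN} @L => [|b] /=; first by rewrite !mul0r mulr0.
  rewrite (_ : N%:Z - u%:Z - b%:Z = N.+1%:Z - u%:Z - b.+1%:Z) //.
    by ring.
  by rewrite !intS; ring.
rewrite ffactS_split PoszD.
have -> : D = L by rewrite /L eN; ring.
(* Without longer paths and fixed points, u = N + 1. The vanishing of [N ^_ u] is then essential, as
   no term on the left matches it. *)
have {D0 eN} x0 : F = 0%N -> b = 0%N -> N ^_ u = 0%N.
  move=> /D0 e0 b0; apply: ffact_small; rewrite -lez_nat.
  by rewrite eN e0 b0 addr0 add0r.
move: (u * N ^_ u.-1)%:Z => y; move: L => L.
case: F x0 => [|F] x0.
  case: b x0 => [|b] x0; last first.
    by rewrite !base0 !slope0 [b.+1.-1]/= factS PoszM; ring.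
  by rewrite x0 // !base0 !slope0; ring.
move: (N ^_ u)%:Z {x0} => x.
rewrite (baseS F b L) slopeS [F.+1.-1]/= intS !mulr2n.
move: (base F.+1 _ _) (base F _ _) (slope F _ _) => *; ring.
Qed.

(** * Invariants of the recursion: depths along the paths *)

Section QueueLemma.
Context (T : finType).
Implicit Types (p : {perm T}) (I Y : {set T}) (q s : seq T) (d e : T -> nat).

(** A path of p restricted to I ends at a point outside I. [singles] counts the one-point paths,
    among them the fixed points of p outside I; [finals] counts the ends of the longer paths. *)
Definition fixed p I Y := #|[set x in Y | (x \in I) && (p x == x)]|.
Definition singles p I Y := #|[set x in Y | (x \notin I) && ((p^-1)%g x \notin I)]|.
Definition finals p I Y := #|[set x in Y | (x \notin I) && ((p^-1)%g x \in I)]|.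

(* d z is the position of z on its path; it is unconstrained at fixed points. *)
Definition is_depth p I d :=
  (forall z, (p^-1)%g z \notin I -> d z = 1%N) /\
  (forall x, x \in I -> p x != x -> d (p x) = (d x).+1).

(** The points of Y on a path form an initial segment, which stops either at the end of the path or
    at a queue element; the depth there is the number of points left, whence [qs_sumd]. In [qs_sume]
    the value of e at a start is the length of the whole path, and e (p x) is the number of points
    already removed beyond the queue element x. *)
Record queue_state p I Y q d e : Prop := QueueState {
  qs_uniq : uniq q;
  qs_sub : forall x, x \in q -> [/\ x \in I, x \in Y & p x \notin Y];
  qs_fwd : forall y, y \in Y -> y \in I -> (p y \in Y) || (y \in q);
  qs_bwd : forall y, y \in I -> p y \in Y -> y \in Y;
  qs_d : is_depth p I d;
  qs_e : is_depth p^-1 (img p I) e;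
  qs_sumd : #|Y| = (fixed p I Y + \sum_(x <- q) d x
                     + \sum_(z in Y | z \notin I) d z)%N;
  qs_sume : (#|Y| + \sum_(x <- q) e (p x)
    = fixed p I Y + \sum_(y in Y | (p^-1)%g y \notin I) e y)%N }.

Lemma card_setD1 Y (P : pred T) z : z \in Y ->
  #|[set x in Y | P x]| = (P z + #|[set x in Y :\ z | P x]|)%N.
Proof.
move=> zY; rewrite (cardsD1 z) !inE zY /=; congr addn; apply: eq_card => x.
by rewrite !inE; case: (x == z).
Qed.

Lemma sum_setD1 Y (P : pred T) (f : T -> nat) z : z \in Y ->
  (\sum_(x in Y | P x) f x =
   (if P z then f z else 0) + \sum_(x in Y :\ z | P x) f x)%N.
Proof.
move=> zY; case: ifP => Pz; first rewrite (bigD1 z) ?zY //=; rewrite ?add0n.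
  by congr addn; apply: eq_bigl => x; rewrite !inE andbC andbA.
by apply: eq_bigl => x; rewrite !inE; case: eqVneq => [->|]; rewrite ?Pz ?andbF.
Qed.

Section Transitions.
Context (p : {perm T}) (I Y : {set T}) (q : seq T) (d e : T -> nat).

Lemma depth_source z : is_depth p I d -> (p^-1)%g z \notin I -> d z = 1%N.
Proof. by case=> + _ => /[apply]. Qed.

Lemma depth_next z : is_depth p I d -> z \notin I -> (p^-1)%g z \in I ->
  d z = (d ((p^-1)%g z)).+1.
Proof.
case=> _ + zI z'I => /(_ _ z'I); rewrite permKV; apply.
by apply: contraNneq zI => ->.
Qed.

Lemma codepth_final z : is_depth p^-1 (img p I) e -> z \notin I -> e z = 1%N.
Proof. by case=> + _ zI; apply; rewrite invgK inE permK. Qed.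

Lemma codepth_next z : is_depth p^-1 (img p I) e -> z \in I -> p z != z ->
  e z = (e (p z)).+1.
Proof.
case=> _ /(_ (p z)); rewrite inE permK => + zI pz; apply => //.
by rewrite eq_sym.
Qed.

Lemma queue_state_single z : queue_state p I Y q d e ->
  z \in Y -> z \notin I -> (p^-1)%g z \notin I -> queue_state p I (Y :\ z) q d e.
Proof.
case=> uq sub fwd bwd dd ee sumd sume zY zI z'I; split=> //.
- move=> x /sub[xI xY pxY]; split=> //; first by rewrite !inE xY andbT; apply: contraNneq zI => <-.
  by rewrite !inE (negPf pxY) andbF.
- move=> y; rewrite !inE => /andP[_ yY] yI.
  have /orP[->|->] := fwd _ yY yI; rewrite ?orbT // andbT.
  by apply/orP; left; apply: contraNneq z'I => <-; rewrite permK.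
- move=> y yI; rewrite !inE => /andP[_ /(bwd _ yI) ->]; rewrite andbT.
  by apply: contraNneq zI => <-.
- move: sumd; rewrite (cardsD1 z) zY /fixed (card_setD1 _ zY) (sum_setD1 _ _ zY).
  by rewrite (negPf zI) (depth_source dd z'I) /=; lia.
- move: sume; rewrite (cardsD1 z) zY /fixed (card_setD1 _ zY) (sum_setD1 _ _ zY).
  by rewrite z'I (codepth_final ee zI) (negPf zI) /=; lia.
Qed.

Lemma queue_state_final z : queue_state p I Y q d e ->
  z \in Y -> z \notin I -> (p^-1)%g z \in I ->
  queue_state p I (Y :\ z) ((p^-1)%g z :: q) d e.
Proof.
case=> uq sub fwd bwd dd ee sumd sume zY zI z'I.
have z'z : (p^-1)%g z != z by apply: contraNneq zI => <-.
split=> //.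
- rewrite /= uq andbT; apply/negP => /sub[_ _].
  by rewrite permKV zY.
- move=> x; rewrite inE => /predU1P[->|/sub[xI xY pxY]]; rewrite !inE ?permKV.
    by rewrite eqxx z'z z'I (bwd _ z'I) ?permKV.
  by rewrite (negPf pxY) andbF xY andbT; split=> //; apply: contraNneq zI => <-.
- move=> y; rewrite !inE => /andP[_ yY] yI.
  have /orP[->|->] := fwd _ yY yI; rewrite ?orbT // andbT.
  by case: (eqVneq (p y) z) => //= <-; rewrite permK eqxx.
- move=> y yI; rewrite !inE => /andP[_ /(bwd _ yI) ->]; rewrite andbT.
  by apply: contraNneq zI => <-.
- move: sumd; rewrite (cardsD1 z) zY /fixed (card_setD1 _ zY) (sum_setD1 _ _ zY).
  by rewrite big_cons (negPf zI) (depth_next dd zI z'I) /=; lia.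
- move: sume; rewrite (cardsD1 z) zY /fixed (card_setD1 _ zY) (sum_setD1 _ _ zY).
  by rewrite big_cons permKV z'I (codepth_final ee zI) (negPf zI) /=; lia.
Qed.

Lemma queue_state_last z : queue_state p I Y (rcons q z) d e ->
  queue_state p I (Y :\ z)
    (if (p^-1)%g z \in I then (p^-1)%g z :: q else q) d e.
Proof.
case=> uq sub fwd bwd dd ee sumd sume.
have [zI zY pzY] : [/\ z \in I, z \in Y & p z \notin Y].
  by apply: sub; rewrite mem_rcons mem_head.
have pz : p z != z by apply: contraNneq pzY => ->.
have z'z : (p^-1)%g z != z by rewrite -{2}(permK p z) (inj_eq perm_inj) eq_sym.
move: uq; rewrite rcons_uniq => /andP[zq uq].
have subq x : x \in q -> [/\ x \in I, x \in Y & p x \notin Y].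
  by move=> xq; apply: sub; rewrite mem_rcons inE xq orbT.
split=> //.
- case: ifP => // _; rewrite /= uq andbT; apply/negP => /subq[_ _].
  by rewrite permKV zY.
- move=> x xq; have : x = (p^-1)%g z /\ (p^-1)%g z \in I \/ x \in q.
    by case: ifP xq => z'I; rewrite ?inE; [case/predU1P|]; auto.
  case=> [[-> z'I]|xq']; rewrite !inE ?permKV.
    by rewrite eqxx z'z z'I (bwd _ z'I) ?permKV.
  have [xI xY /negPf pxY] := subq _ xq'.
  by rewrite pxY andbF xI xY andbT; split=> //; apply: contraNneq zq => <-.
- move=> y; rewrite !inE => /andP[yz yY] yI.
  have := fwd _ yY yI; rewrite mem_rcons inE (negPf yz) /=.
  case: (eqVneq (p y) z) => [pyz|_] /=.
    by move=> _; rewrite -pyz permK yI inE eqxx.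
  by case/orP=> [->//|yq]; apply/orP; right; case: ifP; rewrite // inE yq orbT.
- move=> y yI; rewrite !inE => /andP[_ py].
  rewrite (bwd _ yI py) andbT; apply: contraNneq pzY => <-.
  exact: py.
- move: sumd; rewrite (cardsD1 z) zY /fixed (card_setD1 _ zY) (sum_setD1 _ _ zY).
  rewrite -cats1 big_cat big_seq1 zI (negPf pz) /=.
  case: ifPn => z'I; last by rewrite (depth_source dd z'I); lia.
  have : d z = (d ((p^-1)%g z)).+1.
    by case: dd => _ /(_ _ z'I); rewrite permKV eq_sym; apply.
  by rewrite big_cons; lia.
- move: sume; rewrite (cardsD1 z) zY /fixed (card_setD1 _ zY) (sum_setD1 _ _ zY).
  rewrite -cats1 big_cat big_seq1 zI (negPf pz) /= (codepth_next ee zI pz).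
  case: (boolP (_ \in I)) => z'I /=; last by lia.
  by rewrite big_cons permKV (codepth_next ee zI pz); lia.
Qed.

Lemma queue_state_fixed z : queue_state p I Y [::] d e ->
  z \in Y -> z \in I -> p z = z -> queue_state p I (Y :\ z) [::] d e.
Proof.
case=> uq sub fwd bwd dd ee sumd sume zY zI pz.
have z'z : (p^-1)%g z = z by rewrite -{1}pz permK.
split=> //.
- move=> y; rewrite !inE => /andP[yz yY] yI.
  have := fwd _ yY yI; rewrite in_nil !orbF => ->; rewrite andbT.
  by apply: contraNneq yz => pyz; rewrite -z'z -pyz permK.
- move=> y yI; rewrite !inE => /andP[pyz /(bwd _ yI) ->]; rewrite andbT.
  by apply: contraNneq pyz => ->; rewrite pz.
- move: sumd; rewrite (cardsD1 z) zY /fixed (card_setD1 _ zY) (sum_setD1 _ _ zY).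
  by rewrite big_nil zI pz eqxx /=; lia.
- move: sume; rewrite (cardsD1 z) zY /fixed (card_setD1 _ zY) (sum_setD1 _ _ zY).
  by rewrite big_nil zI z'z zI pz eqxx /=; lia.
Qed.

Lemma imgK : img p^-1 (img p I) = I.
Proof. by apply/setP => x; rewrite !inE invgK permK. Qed.

Lemma fixed_img Z : fixed p^-1 (img p I) Z = fixed p I Z.
Proof.
apply: eq_card => x; rewrite !inE; congr andb.
rewrite -(inj_eq (@perm_inj _ p)) permKV eq_sym.
by case: eqP => [pxx|]; rewrite ?andbF // !andbT -{1}pxx permK.
Qed.

(** The empty queue makes the state symmetric under reversal, so d and e exchange roles, as do the
    two counting identities. *)
Lemma queue_state_start z : queue_state p I Y [::] d e ->
  z \in Y -> z \in I -> (p^-1)%g z \notin I ->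
  queue_state p^-1 (img p I) (Y :\ z) [:: p z] e d.
Proof.
case=> uq sub fwd bwd dd ee sumd sume zY zI z'I.
have pzY : p z \in Y by have := fwd _ zY zI; rewrite orbF.
have pz : p z != z by apply: contraNneq z'I => {1}<-; rewrite permK.
split=> //.
- by move=> x; rewrite inE => /eqP->; rewrite !inE permK eqxx pz zI pzY.
- move=> y; rewrite !inE => /andP[yz yY] y'I.
  rewrite (bwd _ y'I) ?permKV // andbT -(inj_eq (@perm_inj _ p)) permKV.
  by case: eqVneq.
- move=> y; rewrite !inE => y'I /andP[_ y'Y].
  have := fwd _ y'Y y'I; rewrite permKV orbF => ->; rewrite andbT.
  by apply: contraNneq z'I => <-.
- rewrite invgK imgK; exact: dd.
- move: sume; rewrite (cardsD1 z) zY -fixed_img /fixed (card_setD1 _ zY).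
  rewrite (sum_setD1 _ _ zY) big_nil z'I (codepth_next ee zI pz) big_seq1.
  rewrite !inE (negPf z'I) /= => h.
  under eq_bigl do rewrite [_ \in img p I]inE.
  by lia.
- move: sumd; rewrite (cardsD1 z) zY -fixed_img /fixed (card_setD1 _ zY).
  rewrite (sum_setD1 _ _ zY) big_nil zI big_seq1 permK (depth_source dd z'I).
  rewrite !inE (negPf z'I) /= => h.
  under eq_bigl do rewrite [_ \in img p I]inE invgK permK.
  by lia.
Qed.
End Transitions.
End QueueLemma.

(** * Induction proving the closed form *)

Section QueueCount.
Context (T : finType).
Implicit Types (p : {perm T}) (I Y : {set T}) (q s : seq T) (d e : T -> nat).

Definition queue_formula p I Y Q :=
  queue_val #|Y| (singles p I Y) (finals p I Y) (fixed p I Y) Q.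

Definition queue_hyp n := forall p I Y q d e, #|Y| = n -> queue_state p I Y q d e ->
  (queue_count p I Y q)%:Z = queue_formula p I Y (\sum_(x <- q) d x)%N.

Lemma Posz_sum (J : finType) (P : pred J) (f : J -> nat) :
  (\sum_(j | P j) f j)%N%:Z = \sum_(j | P j) (f j)%:Z.
Proof. exact: (big_morph Posz PoszD). Qed.

(** The contribution of last points outside I, common to the cases of empty and nonempty queue. *)
Lemma sum_queue_count_outside n p I Y q d e :
    queue_hyp n -> #|Y| = n.+1 -> queue_state p I Y q d e ->
  (\sum_(z in Y | z \notin I) queue_count p I (Y :\ z)
      (if (p^-1)%g z \in I then (p^-1)%g z :: q else q))%N%:Z =
  (singles p I Y)%:Z * queue_val n (singles p I Y).-1 (finals p I Y) (fixed p I Y)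
                         (\sum_(x <- q) d x)%N
  + (n ^_ (singles p I Y))%:Z *
    ((finals p I Y)%:Z * base (finals p I Y).-1 (fixed p I Y)
        (n%:Z - (singles p I Y)%:Z - (fixed p I Y)%:Z)
     + ((finals p I Y)%:Z * ((\sum_(x <- q) d x)%N%:Z - 1)
        + (\sum_(z in Y | (z \notin I) && ((p^-1)%g z \in I)) d z)%N%:Z)
       * slope (finals p I Y).-1 (fixed p I Y)
           (n%:Z - (singles p I Y)%:Z - (fixed p I Y)%:Z)).
Proof.
move=> IH Yn st; rewrite (bigID (fun z => (p^-1)%g z \notin I)) /= PoszD.
have card1 z : z \in Y -> #|Y :\ z| = n.
  by move=> zY; move: Yn; rewrite (cardsD1 z) zY => -[].
rewrite !Posz_sum; congr (_ + _).
  rewrite mulrC -[X in _ * X]natz mulr_natr /singles -sumr_const.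
  apply: eq_big => [z|z /andP[/andP[zY zI] z'I]]; first by rewrite inE andbA.
  rewrite (negPf z'I) (IH _ _ _ _ _ _ (card1 z zY) (queue_state_single st zY zI z'I)).
  rewrite /queue_formula card1 // /singles /finals /fixed !(card_setD1 _ zY).
  by rewrite (negPf zI) (negPf z'I).
set u := singles p I Y; set F := finals p I Y; set b := fixed p I Y.
set Q := (\sum_(x <- q) d x)%N; set L := n%:Z - u%:Z - b%:Z.
transitivity (\sum_(z in [set x in Y | (x \notin I) && ((p^-1)%g x \in I)])
  ((n ^_ u)%:Z * (base F.-1 b L + (Q%:Z - 1 + (d z)%:Z) * slope F.-1 b L))).
  apply: eq_big => [z|z]; first by rewrite inE negbK andbA.
  rewrite negbK => /andP[/andP[zY zI] z'I].
  rewrite z'I (IH _ _ _ _ _ _ (card1 z zY) (queue_state_final st zY zI z'I)).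
  rewrite /queue_formula card1 // /queue_val.
  have -> : singles p I (Y :\ z) = u.
    by rewrite /u /singles (card_setD1 _ zY) z'I andbF.
  have -> : fixed p I (Y :\ z) = b.
    by rewrite /b /fixed (card_setD1 _ zY) (negPf zI).
  have -> : finals p I (Y :\ z) = F.-1.
    by rewrite /F /finals (card_setD1 _ zY) zI z'I.
  rewrite -/L big_cons -/Q (depth_next (qs_d st) zI z'I) PoszD intS.
  by congr (_ * (_ + _ * _)); ring.
rewrite -mulr_sumr; congr (_ * _).
rewrite big_split /= sumr_const -mulr_suml big_split /= sumr_const -/F.
rewrite -[base _ _ _ *+ F]mulr_natl -[(_ - 1) *+ F]mulr_natl !natz.
by under eq_bigl do rewrite inE.
Qed.

Lemma finals_outside p I Y (d : T -> nat) :
  (forall z, (p^-1)%g z \notin I -> d z = 1%N) ->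
  (\sum_(z in Y | z \notin I) d z =
   singles p I Y + \sum_(z in Y | (z \notin I) && ((p^-1)%g z \in I)) d z)%N.
Proof.
move=> d1; rewrite (bigID (fun z => (p^-1)%g z \notin I)) /=; congr addn.
  rewrite /singles -sum1_card; apply: eq_big => [z|z /andP[_ /d1]] //.
  by rewrite inE andbA.
by apply: eq_bigl => z; rewrite negbK andbA.
Qed.

Lemma sum_finals0 p I Y (d : T -> nat) : finals p I Y = 0%N ->
  (\sum_(z in Y | (z \notin I) && ((p^-1)%g z \in I)) d z)%N = 0%N.
Proof.
move=> /eqP; rewrite cards_eq0 => /eqP F0; apply: big1 => z zP.
by have := in_set0 z; rewrite -F0 inE zP.
Qed.

Lemma queue_count_rec p I Y q d e n : queue_hyp n -> #|Y| = n.+1 ->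
  queue_state p I Y q d e -> (0 < size q)%N ->
  (queue_count p I Y q)%:Z = queue_formula p I Y (\sum_(x <- q) d x)%N.
Proof.
case/lastP: q => // q z IH Yn st _.
have [zI zY pzY] := qs_sub st (eq_ind_r is_true (mem_head z q) (mem_rcons q z z)).
have pz : p z != z by apply: contraNneq pzY => ->.
rewrite queue_count_rcons // PoszD (sum_queue_count_outside IH Yn st).
have st' := queue_state_last st.
have Yzn : #|Y :\ z| = n by move: Yn; rewrite (cardsD1 z) zY => -[].
rewrite (IH _ _ _ _ _ _ Yzn st') /queue_formula Yzn Yn.
have -> : singles p I (Y :\ z) = singles p I Y.
  by rewrite [RHS](card_setD1 _ zY) zI.
have -> : finals p I (Y :\ z) = finals p I Y.
  by rewrite [RHS](card_setD1 _ zY) zI.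
have -> : fixed p I (Y :\ z) = fixed p I Y.
  by rewrite [RHS](card_setD1 _ zY) zI (negPf pz).
set Q := (\sum_(x <- rcons q z) d x)%N.
(* Either z is replaced by its predecessor, of depth one less, or z starts its path and has depth
   1. *)
have -> : (\sum_(x <- if (p^-1)%g z \in I then (p^-1)%g z :: q else q) d x)%N%:Z
    = Q%:Z - 1.
  rewrite /Q -cats1 big_cat big_seq1 /=; case: ifPn => z'I.
    have -> : d z = (d ((p^-1)%g z)).+1.
      case: (qs_d st) => _ /(_ _ z'I); rewrite permKV; apply.
      by rewrite -{1}(permK p z) (inj_eq perm_inj).
    by rewrite big_cons; lia.
  by rewrite (depth_source (qs_d st) z'I); lia.
apply: queue_val_queue => [|/sum_finals0->//].
rewrite -Yn (qs_sumd st) (finals_outside Y (qs_d st).1) !PoszD; ring.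
Qed.

Lemma queue_count_rec_nil p I Y d e n : queue_hyp n -> #|Y| = n.+1 ->
  queue_state p I Y [::] d e ->
  (queue_count p I Y [::])%:Z = queue_formula p I Y 0.
Proof.
move=> IH Yn st; have Y0 : Y != set0 by rewrite -card_gt0 Yn.
have card1 z : z \in Y -> #|Y :\ z| = n.
  by move=> zY; move: Yn; rewrite (cardsD1 z) zY => -[].
rewrite queue_count_nil // !PoszD (sum_queue_count_outside IH Yn st) big_nil.
rewrite /queue_formula Yn.
set u := singles p I Y; set F := finals p I Y; set b := fixed p I Y.
set L := n%:Z - u%:Z - b%:Z.
set D := (\sum_(z in Y | _) d z)%N.
(* With an empty queue p maps the points of Y in I onto the points of Y in p(I); dropping the common
   points leaves as many starts as ends. *)
have eF : #|[set x in Y | (x \in I) && ((p^-1)%g x \notin I)]| = F.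
  have : #|[set x in Y | x \in I]| = #|[set x in Y | (p^-1)%g x \in I]|.
    rewrite -(card_imset _ (@perm_inj _ p)); apply: eq_card => y.
    rewrite -[y in LHS](permKV p) mem_imset ?inE //; last exact: perm_inj.
    apply/andP/andP => -[yY yI]; split=> //.
      by have := qs_fwd st yY yI; rewrite permKV orbF.
    by apply: (qs_bwd st); rewrite ?permKV.
  rewrite /F /finals -!sum1_card.
  rewrite (bigID (fun x => (p^-1)%g x \in I)) [RHS](bigID (mem I)) /=.
  rewrite (eq_bigl (fun x => (x \in [set x in Y | (p^-1)%g x \in I]) && (x \in I))); last first.
    by move=> x; rewrite !inE -!andbA; congr andb; rewrite andbC.
  move/addnI => h; rewrite (eq_bigl (fun x => (x \in [set x in Y | x \in I]) && ((p^-1)%g x \notin I))).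
    by rewrite h; apply: eq_bigl => x; rewrite !inE -!andbA; congr andb; rewrite andbC.
  by move=> x; rewrite !inE andbA.
(* Both sides count the points of Y on the longer paths, once from the starts and once from the
   ends. *)
have eD : (\sum_(z in Y | (z \in I) && ((p^-1)%g z \notin I)) e z)%N = D.
  have := qs_sume st; rewrite {1}(qs_sumd st) (finals_outside Y (qs_d st).1) -/u -/b -/D.
  rewrite !big_nil !addn0 => /addnI.
  rewrite (bigID (mem I)) /=.
  have -> : (\sum_(i | (i \in Y) && ((p^-1)%g i \notin I) && (i \notin I)) e i)%N = u.
    rewrite /u /singles -sum1_card; apply: eq_big => [x|x /andP[/andP[_ _] xI]].
      by rewrite inE -andbA; congr andb; rewrite andbC.
    exact: codepth_final (qs_e st) xI.
  rewrite [RHS]addnC => /addnI ->; apply: eq_bigl => x.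
  by rewrite -andbA; congr andb; rewrite andbC.
have -> : (\sum_(z in Y | (z \in I) && ((p^-1)%g z \notin I))
    queue_count p^-1 (img p I) (Y :\ z) [:: p z])%N%:Z =
  (n ^_ u)%:Z * (F%:Z * base F.-1 b L + (D%:Z - F%:Z) * slope F.-1 b L).
  rewrite Posz_sum.
  transitivity (\sum_(z in [set x in Y | (x \in I) && ((p^-1)%g x \notin I)])
    ((n ^_ u)%:Z * (base F.-1 b L + ((e z)%:Z - 1) * slope F.-1 b L))).
    apply: eq_big => [z|z /andP[zY /andP[zI z'I]]]; first by rewrite inE.
    have pz : p z != z by apply: contraNneq z'I => {1}<-; rewrite permK.
    rewrite (IH _ _ _ _ _ _ (card1 z zY) (queue_state_start st zY zI z'I)).
    rewrite /queue_formula card1 // /queue_val fixed_img.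
    have -> : singles p^-1 (img p I) (Y :\ z) = u.
      rewrite /u /singles (card_setD1 _ zY) zI /=; apply: eq_card => x.
      by rewrite !inE invgK permK -!andbA; congr (_ && (_ && _)); rewrite andbC.
    have -> : fixed p I (Y :\ z) = b.
      by rewrite /b /fixed (card_setD1 _ zY) zI (negPf pz).
    have -> : finals p^-1 (img p I) (Y :\ z) = F.-1.
      rewrite -eF (card_setD1 _ zY) zI z'I /=; apply: eq_card => x.
      by rewrite !inE invgK permK -!andbA; congr (_ && (_ && _)); rewrite andbC.
    rewrite -/L big_seq1 (codepth_next (qs_e st) zI pz) intS.
    by congr (_ * (_ + _ * _)); ring.
  rewrite -mulr_sumr; congr (_ * _).
  rewrite big_split /= sumr_const -mulr_suml big_split /= sumr_const eF.
  rewrite -[base _ _ _ *+ F]mulr_natl -[(- 1) *+ F]mulr_natl !natz mulrN1 -eD Posz_sum.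
  by under eq_bigl do rewrite inE.
have -> : (\sum_(z in Y | (z \in I) && (p z == z)) queue_count p I (Y :\ z) [::])%N%:Z =
   b%:Z * queue_val n u F b.-1 0.
  rewrite Posz_sum mulrC -[X in _ * X]natz mulr_natr /b /fixed -sumr_const.
  apply: eq_big => [z|z /andP[zY /andP[zI /eqP pz]]]; first by rewrite inE.
  have z'z : (p^-1)%g z = z by rewrite -{1}pz permK.
  rewrite (IH _ _ _ _ _ _ (card1 z zY) (queue_state_fixed st zY zI pz)).
  rewrite /queue_formula card1 // big_nil /u /F /singles /finals /fixed.
  by rewrite !(card_setD1 _ zY) zI pz eqxx z'z zI.
rewrite -(@queue_val_nil n u F b D%:Z) => [||/sum_finals0 D0]; last by rewrite /D D0.
  rewrite -/L mulr2n; set X := base _ _ _; set X' := slope _ _ _.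
  by ring.
rewrite -Yn (qs_sumd st) (finals_outside Y (qs_d st).1) big_nil !PoszD -/u -/b -/D; ring.
Qed.

(** The induction on the size of Y generalizes p, I, d and e as well, since the mirror step changes
    them. *)
Theorem queue_countE p I Y q d e : queue_state p I Y q d e ->
  (queue_count p I Y q)%:Z = queue_formula p I Y (\sum_(x <- q) d x)%N.
Proof.
suff H n : queue_hyp n by apply: H (erefl _).
elim: n => [|n IH] {}p {}I {}Y {}q {}d {}e Yn st; last first.
  case: q st => [|x q] st; last exact: queue_count_rec IH Yn st _.
  by rewrite big_nil (queue_count_rec_nil IH Yn st).
have Y0 : Y = set0 by apply/eqP; rewrite -cards_eq0 Yn.
case: q st => [|x q] st.
  have c0 (P : pred T) : #|[set x in Y | P x]| = 0%N.
    by rewrite Y0; apply: eq_card0 => x; rewrite !inE.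
  rewrite /queue_formula Yn /singles /finals /fixed !c0 Y0 /queue_count enum_set0.
  by rewrite /permutations /= /queue_val base0 slope0 mulr0 addr0.
by have [_] := qs_sub st (mem_head x q); rewrite Y0 inE.
Qed.
End QueueCount.

(** * Initial states, and sets containing a nontrivial cycle *)

Section Acyclic.
Context (T : finType).
Implicit Types (p : {perm T}) (I Y : {set T}) (s : seq T) (d e : T -> nat).

Definition acyclic p I :=
  [forall x in I, (p x != x) ==> ~~ (porbit p x \subset I)].

Lemma acyclicP p I : reflect
  (forall x, x \in I -> p x != x -> exists2 y, y \in porbit p x & y \notin I)
  (acyclic p I).
Proof.
apply: (iffP forall_inP) => h x xI.
  by move=> px; have := h x xI; rewrite px => /subsetPn.
by apply/implyP => /(h x xI) ?; apply/subsetPn.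
Qed.

Lemma porbit_next p x : porbit p (p x) = porbit p x.
Proof. by rewrite -(porbit_perm p 1 x) expg1. Qed.

Lemma acyclic_img p I : acyclic p I -> acyclic p^-1 (img p I).
Proof.
move=> /acyclicP h; apply/acyclicP => x; rewrite inE => x'I x'x.
have [|y yx yI] := h _ x'I; first by rewrite permKV eq_sym.
exists (p y); last by rewrite inE permK.
rewrite porbitV -(permKV p x) porbit_next -eq_porbit_mem porbit_next.
by rewrite eq_porbit_mem.
Qed.

(** The depth counts the backward steps needed until the preimage leaves I. The bounded search fails
    only at fixed points in I, where the value is immaterial. *)
Lemma acyclic_depth p I : acyclic p I -> exists d, is_depth p I d.
Proof.
move=> /acyclicP h; pose hit x t := iter t.+1 (p^-1)%g x \notin I.
pose d x := (find (hit x) (iota 0 #|T|.+1)).+1.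
exists d; split=> [z z'I | x xI px]; first by rewrite /d /= /hit /= z'I.
rewrite /d; congr S.
have -> : find (hit (p x)) (iota 0 #|T|.+1) = (find (hit x) (iota 0 #|T|)).+1.
  rewrite /= {1}/hit /= permK xI /=; congr S; rewrite -[1%N]addn0 iotaDl find_map.
  by apply: eq_find => t; rewrite /hit /= -iterS iterSr permK.
rewrite -[X in iota 0 X.+1]addn0 -addnS iotaD find_cat.
case: ifPn => // /hasPn nohit; have [y] := h x xI px.
rewrite -porbitV porbit_traject => /trajectP[[|t] tn ->]; first by rewrite xI.
move/negP; case; have := nohit t; rewrite /hit negbK; apply.
by rewrite mem_iota add0n; apply: leq_trans (ltnW tn) (max_card _).
Qed.

(** Compare the sums of d (p x) and of d x, equal by reindexing: on I the terms differ by 1 except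
    at fixed points, and off I the former are 1. *)
Lemma depth_sum p I d : is_depth p I d ->
  #|[set: T]| = (fixed p I [set: T] + \sum_(z in [set: T] | z \notin I) d z)%N.
Proof.
move=> [d1 dS].
have : (\sum_x d (p x) = \sum_x d x)%N by rewrite [RHS](reindex_inj (@perm_inj _ p)).
rewrite (bigID (mem I)) [RHS](bigID (mem I)) /=.
rewrite [X in (_ + X)%N = _](eq_bigr (fun=> 1%N)); last first.
  by move=> z zI; apply: d1; rewrite permK.
rewrite (eq_bigr (fun x => d x + (p x != x))%N); last first.
  move=> x xI; case: eqVneq => [->|/(dS _ xI)->]; by rewrite ?addn0 ?addn1.
rewrite big_split /= -addnA => /addnI E.
rewrite [X in (_ + X)%N](eq_bigl (fun z => z \notin I)) -?E; last first.
  by move=> z; rewrite inE.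
rewrite cardsT -sum1_card (bigID (mem I)) /= addnA; congr addn.
have -> : fixed p I setT = (\sum_(x in I | p x == x) 1)%N.
  by rewrite sum1_card; apply: eq_card => x; rewrite !inE.
by rewrite big_mkcondr -big_split /=; apply: eq_bigr => x _; case: eqP.
Qed.

Lemma queue_state_full p I : acyclic p I ->
  exists d e, queue_state p I [set: T] [::] d e.
Proof.
move=> ac; have [d dd] := acyclic_depth ac.
have [e ee] := acyclic_depth (acyclic_img ac).
exists d, e; split=> //; rewrite ?big_nil ?addn0.
- by move=> y _ _; rewrite inE.
- exact: depth_sum.
- by rewrite (depth_sum ee) fixed_img; congr addn; apply: eq_bigl => y; rewrite !inE.
Qed.

Theorem queue_count_full p I : acyclic p I ->
  (queue_count p I [set: T] [::])%:Z = queue_formula p I [set: T] 0.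
Proof. by move=> /queue_state_full[d [e /queue_countE->]]; rewrite big_nil. Qed.

(** On a nontrivial cycle C inside I, the source list is C in its order and the target list is the
    image of that list under the inverse of p. If they agreed, p would fix C pointwise. *)
Lemma queue_count_cyclic p I : ~~ acyclic p I -> queue_count p I [set: T] [::] = 0%N.
Proof.
rewrite negb_forall_in => /exists_inP[x xI]; rewrite negb_imply negbK.
case/andP=> px /subsetP CI; apply/eqP; rewrite -leqn0 leqNgt -has_count.
apply/hasPn => s; rewrite mem_permutations cats0 => /perm_mem sT.
apply: contra px => /eqP E; pose C := porbit p x.
have CV z : ((p^-1)%g z \in C) = (z \in C).
  by rewrite -!eq_porbit_mem -(porbit_next p (_ z)) permKV.
have: [seq z <- sources I s | z \in C] = [seq z <- targets p I s | z \in C].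
  by rewrite E.
rewrite /sources /targets filter_map -!filter_predI.
rewrite (eq_filter (a2 := mem C)); last first.
  by move=> z /=; case: (boolP (z \in C)) => //= /CI.
rewrite [in RHS](eq_filter (a2 := mem C)) => [|z /=]; last first.
  by rewrite -(CV z); case: (boolP (_ \in C)) => //= /CI.
rewrite -[LHS]map_id => /eq_in_map/(_ (p x)); rewrite mem_filter sT mem_enum inE.
by rewrite in_setT andbT -CV permK porbit_id => -> //.
Qed.
End Acyclic.

(** * From increasing patterns to linear orders, by averaging over conjugation *)

Lemma conj_increasing (T : finType) (s t : {perm T}) (I : {set T}) (r : seq T) :
  (sources I r == targets s I r) =
  (sources (t @: I) (map t r) == targets (s ^ t)%g (t @: I) (map t r)).
Proof.
have sE x : ((s ^ t)^-1)%g (t x) = t ((s^-1)%g x) by rewrite -conjVg permJ.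
have -> : sources (t @: I) (map t r) = map t (sources I r).
  rewrite /sources filter_map; congr map; apply: eq_filter => x /=.
  by rewrite mem_imset //; exact: perm_inj.
have -> : targets (s ^ t)%g (t @: I) (map t r) = map t (targets s I r).
  rewrite /targets filter_map -!map_comp.
  rewrite (eq_filter (a2 := [pred y | (s^-1)%g y \in I])); last first.
    by move=> x /=; rewrite sE mem_imset //; exact: perm_inj.
  by apply: eq_map => x /=; rewrite sE.
by rewrite (inj_eq (inj_map (@perm_inj _ t))).
Qed.

Section Increasing.
Context (n : nat).
Implicit Types (s t : 'S_n) (I : {set 'I_n}).
Let lt_ord : rel 'I_n := fun i j => (i < j)%N.

Lemma lt_ord_sorted_eq (r1 r2 : seq 'I_n) :
  sorted lt_ord r1 -> sorted lt_ord r2 -> r1 =i r2 -> r1 = r2.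
Proof.
apply: irr_sorted_eq => [i j k|i]; [exact: ltn_trans|exact: ltnn].
Qed.

Lemma sources_enum_sorted I : sorted lt_ord (sources I (enum 'I_n)).
Proof.
apply: sorted_filter; first by move=> i j k; apply: ltn_trans.
have: sorted ltn (map val (enum 'I_n)) by rewrite val_enum_ord iota_ltn_sorted.
by rewrite sorted_map.
Qed.

Lemma mem_sources_enum I : sources I (enum 'I_n) =i I.
Proof. by move=> i; rewrite mem_filter mem_enum inE andbT. Qed.

(** An index sequence is the increasing enumeration of a set I. Its image is increasing iff it is
    the increasing enumeration of s(I), which is the target list mapped by s. *)
Lemma Nid_sets k s : Nid k s =
  #|[set I : {set 'I_n} | (#|I| == k) &&
      (sources I (enum 'I_n) == targets s I (enum 'I_n))]|.
Proof.
pose f (u : k.-tuple 'I_n) := [set x in u].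
have fK (u : k.-tuple 'I_n) : sorted lt_ord u -> sources (f u) (enum 'I_n) = u.
  move=> us; apply: lt_ord_sorted_eq us _ => [|i]; first exact: sources_enum_sorted.
  by rewrite mem_sources_enum inE.
rewrite /Nid -(card_in_imset (f := f)); last first.
  move=> u v; rewrite !inE => /andP[us _] /andP[vs _] E; apply: val_inj.
  by rewrite /= -(fK u us) -(fK v vs) E.
apply: eq_card => I; rewrite !inE; apply/imsetP/andP => [[u]|[/eqP Ik /eqP E]].
  rewrite inE => /andP[us sus] ->; rewrite fK //; split.
    have uu : uniq u by apply: sorted_uniq us => [i j l|i]; [exact: ltn_trans|exact: ltnn].
    by rewrite cardsE (card_uniqP uu) size_tuple.
  apply/eqP/(inj_map (@perm_inj _ s)); rewrite -sources_img.
  apply: lt_ord_sorted_eq sus (sources_enum_sorted _) _ => i.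
  by rewrite mem_sources_enum !inE -{1}(permKV s i) mem_map //; exact: perm_inj.
have sz : size (enum I) == k by rewrite -cardE Ik.
exists (Tuple sz); last by apply/setP => i; rewrite !inE mem_enum.
have eI : enum I = sources I (enum 'I_n) by rewrite /sources enumT.
rewrite inE [tval _]/= eI sources_enum_sorted /=.
by rewrite E -sources_img sources_enum_sorted.
Qed.

Lemma map_perm_permutations :
  perm_eq [seq map t (enum 'I_n) | t : 'S_n] (permutations (enum [set: 'I_n])).
Proof.
apply: uniq_perm; rewrite ?permutations_uniq //.
  rewrite map_inj_uniq ?enum_uniq // => t t' /eq_in_map E; apply/permP => i.
  by apply: E; rewrite mem_enum.
move=> s; rewrite mem_permutations; apply/mapP/idP => [[t _ ->]|Es].
  apply: uniq_perm; rewrite ?(map_inj_uniq (@perm_inj _ t)) ?enum_uniq // => i.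
  by rewrite mem_enum inE -(permKV t i) mem_map ?mem_enum //; exact: perm_inj.
have sn : size s == n by rewrite (perm_size Es) -cardE cardsT card_ord.
have us : uniq s by rewrite (perm_uniq Es) enum_uniq.
have fi : injective (tnth (Tuple sn)) by apply/tuple_uniqP.
exists (perm fi); rewrite ?mem_enum // (eq_map (permE fi)).
by rewrite map_tnth_enum.
Qed.

(** Conjugating s by t amounts to keeping s and reordering the points; as t varies, every linear
    order occurs once. *)
Lemma sum_Nid_conj k s : (\sum_(t : 'S_n) Nid k (s ^ t)%g =
  \sum_(I : {set 'I_n} | #|I| == k) queue_count s I [set: 'I_n] [::])%N.
Proof.
pose P I (r : seq 'I_n) := sources I r == targets s I r.
transitivity (\sum_(t : 'S_n) \sum_(I : {set 'I_n} | #|I| == k)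
    P I (map t^-1%g (enum 'I_n)))%N.
  apply: eq_bigr => t _; rewrite Nid_sets -sum1_card.
  rewrite (reindex_inj (h := fun I => t @: I)) /=; last exact/imset_inj/perm_inj.
  rewrite big_mkcond [RHS]big_mkcond; apply: eq_bigr => I _.
  rewrite inE card_imset; last exact: perm_inj.
  case: eqP => //= _.
  have eE : enum 'I_n = map t (map t^-1%g (enum 'I_n)).
    by rewrite -map_comp map_id_in // => x _ /=; rewrite permKV.
  rewrite /P (conj_increasing s t) -eE.
  have nb (b : bool) : (if b then 1 else 0)%N = b by case: b.
  exact: nb.
rewrite exchange_big; apply: eq_bigr => I _ /=.
rewrite (reindex_inj invg_inj) /=; under eq_bigr do rewrite invgK.
rewrite /queue_count (eq_count (a2 := P I)); last by move=> r; rewrite /= cats0.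
rewrite -(seq.permP map_perm_permutations) count_map -sum1_count big_enum_cond /=.
by rewrite [RHS]big_mkcond; apply: eq_bigr => t _; case: (P _ _).
Qed.
End Increasing.

(** * Transfer matrices and marked cycles *)

Section Transfer.
Context (R : comNzRingType) (T : finType) (y z : R).

(** Here a and b tell whether a point and its image lie in I. An image outside I is a one-point
    path, marked y, or the end of a longer path, marked z. *)
Definition arc_weight (a b : bool) : R := if b then 1 else if a then z else y.

(** The entries of the power n + 1 of the matrix of arc weights; hence the predecessor in
    [cycle_weight]. *)
Fixpoint transfer (n : nat) (a b : bool) : R :=
  if n is n'.+1 then
    arc_weight a false * transfer n' false b + arc_weight a true * transfer n' true b
  else arc_weight a b.

Definition cycle_weight (c : nat) : R :=
  transfer c.-1 false false + transfer c.-1 true true - 1.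

(** Cayley-Hamilton: the matrix has trace 1 + y and determinant y - z. *)
Lemma transfer_rec n a b :
  transfer n.+2 a b = (1 + y) * transfer n.+1 a b - (y - z) * transfer n a b.
Proof. by case: a; rewrite /= /arc_weight; ring. Qed.

(** The characteristic polynomial is (X - 1)(X^2 - (1 + y) X + (y - z)), its first factor coming
    from the subtracted 1. At c = 0 the truncated predecessor would give the wrong power. *)
Lemma cycle_weight_rec c : (0 < c)%N ->
  cycle_weight (c + 3) = (y + 2) * cycle_weight (c + 2)
    - (1 + y *+ 2 - z) * cycle_weight (c + 1) + (y - z) * cycle_weight c.
Proof.
case: c => // c _; rewrite /cycle_weight !addSn !addnS addn0 ![_.-1]/=.
rewrite 2!(transfer_rec c.+1) 2!(transfer_rec c) mulr2n; ring.
Qed.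

Lemma sum_subsets (A U : {set T}) (F : {set T} -> R) : A \subset U ->
  \sum_(I : {set T} | I \subset U) F I =
  \sum_(E : {set T} | E \subset A) \sum_(J : {set T} | J \subset U :\: A) F (E :|: J).
Proof.
move=> AU; rewrite pair_big /=.
rewrite (reindex_onto (fun EJ : {set T} * {set T} => EJ.1 :|: EJ.2)
   (fun I => (I :&: A, I :\: A))) => [|I _]; last by rewrite /= setID.
apply: eq_bigl => -[E J] /=; rewrite xpair_eqE.
apply/andP/andP => -[].
  rewrite subUset => /andP[EU JU] /andP[/eqP e1 /eqP e2]; split.
    by rewrite -e1 subsetIr.
  by rewrite -e2 setSD // subUset EU.
move=> EA JA; have JU : J \subset U by apply: subset_trans JA (subsetDl _ _).
have JA0 : J :&: A = set0.
  by apply/eqP; rewrite setI_eq0; move: JA; rewrite subsetD => /andP[].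
split; first by rewrite subUset JU (subset_trans EA).
rewrite setIUl JA0 setU0 (setIidPl EA) eqxx setDUl.
have -> : E :\: A = set0 by apply/eqP; rewrite setD_eq0.
by rewrite set0U; apply/eqP/setDidPl; rewrite -setI_eq0 JA0.
Qed.

Fixpoint chain_weight (E : {set T}) (a : bool) (s : seq T) (b : bool) : R :=
  if s is x :: s' then arc_weight a (x \in E) * chain_weight E (x \in E) s' b
  else arc_weight a b.

Lemma eq_in_chain_weight (E E' : {set T}) a s b : {in s, forall u, (u \in E) = (u \in E')} ->
  chain_weight E a s b = chain_weight E' a s b.
Proof.
elim: s a => //= x s IH a h; rewrite h ?mem_head // IH // => x' x's.
by rewrite h // inE x's orbT.
Qed.

Lemma sum_subsets_cons x s (F : {set T} -> R) : x \notin s ->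
  \sum_(E : {set T} | E \subset [set u in x :: s]) F E =
  \sum_(J : {set T} | J \subset [set u in s]) F J
  + \sum_(J : {set T} | J \subset [set u in s]) F (x |: J).
Proof.
move=> xs; rewrite (@sum_subsets [set x]); last by rewrite sub1set !inE eqxx.
have -> : [set u in x :: s] :\: [set x] = [set u in s].
  by apply/setP => v; rewrite !inE; case: eqVneq => // ->; rewrite (negPf xs).
rewrite (bigD1 set0) ?sub0set //= [X in _ + X](bigD1 [set x]) /=; last first.
  by rewrite subxx; apply/set0Pn; exists x; rewrite inE.
rewrite [X in _ + (_ + X)]big1 ?addr0 => [|E]; last first.
  by rewrite subset1 => /andP[/andP[/orP[]/eqP->]]; rewrite eqxx.
by congr (_ + _); apply: eq_bigr => J _; rewrite set0U.
Qed.

Lemma chain_weight_setU1 x s (J : {set T}) a b : x \notin s ->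
  chain_weight (x |: J) a s b = chain_weight J a s b.
Proof.
move=> xs; apply: eq_in_chain_weight => v vs /=; rewrite !inE.
by case: eqVneq => // vx; rewrite -vx vs in xs.
Qed.

Lemma subset_seqN x (s : seq T) (J : {set T}) : x \notin s -> J \subset [set u in s] ->
  (x \in J) = false.
Proof. by move=> xs /subsetP Js; apply/negP => /Js; rewrite inE (negPf xs). Qed.

(** Summing over the memberships of the interior points is matrix multiplication. *)
Lemma sum_chain_weight a s b : uniq s ->
  \sum_(E : {set T} | E \subset [set x in s]) chain_weight E a s b
  = transfer (size s) a b.
Proof.
elim: s a => [|x s IH] a /=.
  rewrite set_nil => _; rewrite (big_pred1 set0) // => E /=.
  by rewrite subset0.
case/andP=> xs us; rewrite sum_subsets_cons // -!IH // !mulr_sumr.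
congr (_ + _); apply: eq_bigr => J Js.
  by rewrite (subset_seqN xs Js).
by rewrite !inE eqxx chain_weight_setU1.
Qed.

Lemma chain_weight_fpath (p : T -> T) (E : {set T}) x s x' :
  path (frel p) x (rcons s x') ->
  chain_weight E (x \in E) s (x' \in E) =
  \prod_(u <- x :: s) arc_weight (u \in E) (p u \in E).
Proof.
elim: s x => [|v s IH] x /=; first by rewrite andbT big_seq1 => /eqP->.
by case/andP=> /eqP xv /IH ->; rewrite [RHS]big_cons xv.
Qed.

(** Over all subsets of the cycle the sum is a trace of a matrix power; the excluded full set has
    weight 1. *)
Lemma sum_cycle_weight (p : T -> T) t : uniq t -> (0 < size t)%N -> fcycle p t ->
  \sum_(E : {set T} | (E \subset [set x in t]) && (E != [set x in t]))
     \prod_(u <- t) arc_weight (u \in E) (p u \in E) = cycle_weight (size t).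
Proof.
move=> ut t0 ct.
have pt u : u \in t -> p u \in t.
  move=> ut'; have /= /eqP -> := next_cycle ct ut'; by rewrite mem_next.
apply/eqP; rewrite /cycle_weight eq_sym subr_eq; apply/eqP.
transitivity (\sum_(E : {set T} | E \subset [set x in t])
     \prod_(u <- t) arc_weight (u \in E) (p u \in E)); last first.
  rewrite (bigD1 [set x in t]) //= addrC; congr (_ + _).
  by rewrite big_seq big1 // => u /pt put; rewrite !inE put.
case: t t0 ut ct {pt} => [|x s] // _ /= /andP[xs us] ct.
rewrite (eq_bigr (fun E : {set T} => chain_weight E (x \in E) s (x \in E))); last first.
  by move=> E _; rewrite (chain_weight_fpath _ ct).
rewrite sum_subsets_cons // -!sum_chain_weight //.
congr (_ + _); apply: eq_bigr => J Js.
  by rewrite (subset_seqN xs Js).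
by rewrite !inE eqxx chain_weight_setU1.
Qed.
End Transfer.

(** * Peeling marked cycles off a permutation *)

Section Peel.
Context (R : comNzRingType) (T : finType) (x y z : R).
Implicit Types (p r : {perm T}) (I U V : {set T}) (cs : seq nat).

Definition vertex_weight p I u : R :=
  arc_weight y z (u \in I) (p u \in I) * (if (u \in I) && (p u == u) then x else 1).

Definition weight p I U : R := \prod_(u in U) vertex_weight p I u.

Fixpoint marked cs U p : nat :=
  if cs is c :: cs' then
    (\sum_(u in U | #|porbit p u| == c) marked cs' (U :\: porbit p u) p)%N
  else 1%N.

Definition marked_sum cs U : R :=
  \sum_(p | perm_on U p) \sum_(I : {set T} | (I \subset U) && acyclic p I)
    (marked cs U p)%:R * weight p I U.

(** Its c-fold iterate sums over the ordered choices of c distinct points to delete; iterates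
    compose, so the grouping of the deleted points into cycles is forgotten. *)
Definition dropsum (F : {set T} -> R) U : R := \sum_(u in U) F (U :\ u).

Lemma iter_dropsumZ c w F U :
  iter c dropsum (fun V => w * F V) U = w * iter c dropsum F U.
Proof.
elim: c U => //= c IH U; rewrite /dropsum mulr_sumr.
by apply: eq_bigr => u _; apply: IH.
Qed.

Lemma eq_iter_dropsum c F G U : F =1 G ->
  iter c dropsum F U = iter c dropsum G U.
Proof. by move=> FG; elim: c U => //= c IH U; apply: eq_bigr => u _. Qed.

Lemma sum_uniq_tuples c F U :
  \sum_(t : c.-tuple T | uniq t && ([set u in t] \subset U)) F (U :\: [set u in t])
  = iter c dropsum F U.
Proof.
elim: c U => [|c IH] U.
  rewrite (big_pred1 [tuple]) => [|t].
    by rewrite set_nil setD0.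
  case: t => -[|//] st /=; rewrite set_nil sub0set.
  by apply/esym/eqP/val_inj.
rewrite iterS /dropsum -/dropsum.
under [RHS]eq_bigr do rewrite -IH.
rewrite pair_big_dep /=.
rewrite (reindex (fun ut : T * c.-tuple T => cons_tuple ut.1 ut.2)) /=; last first.
  exists (fun t => (thead t, behead_tuple t)) => [[u t] _|t _] /=.
    by rewrite theadE; congr pair; apply: val_inj.
  by rewrite [RHS]tuple_eta; apply: val_inj.
apply: eq_big => [[u t]|[u t] _] /=; last first.
  by congr F; apply/setP => v; rewrite !inE negb_or andbA [_ && (v != u)]andbC.
rewrite subsetD1 inE.
have -> : [set v in u :: t] = u |: [set v in t] by apply/setP => v; rewrite !inE.
rewrite subUset sub1set.
by case: (u \in t); case: (u \in U); case: (uniq t); rewrite ?andbF ?andbT.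
Qed.

Lemma porbit_fconnect p u v : (v \in porbit p u) = fconnect p u v.
Proof.
apply/porbitP/idP => [[i ->]|h]; first by rewrite permX fconnect_iter.
by exists (findex p u v); rewrite permX iter_findex.
Qed.

Lemma porbit_orbit p u : porbit p u = [set v in fingraph.orbit p u].
Proof. by apply/setP => v; rewrite inE porbit_fconnect fconnect_orbit. Qed.

Lemma order_porbit p u : fingraph.order p u = #|porbit p u|.
Proof. by apply: eq_card => v; rewrite porbit_fconnect. Qed.

Lemma porbit_fcycle p t u : fcycle p t -> u \in t -> porbit p u = [set v in t].
Proof.
move=> ct ut; apply/setP => v; rewrite inE porbit_fconnect.
by rewrite (fconnect_cycle ct ut).
Qed.

Lemma porbit_closed p V u : {in V, forall v, p v \in V} -> u \in V -> porbit p u \subset V.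
Proof.
move=> pV uV; apply/subsetP => v /porbitP[i ->].
by elim: i => [|i IH]; rewrite ?perm1 // expgSr permM pV.
Qed.

(** A point on a c-cycle is the same datum as that cycle listed from the point onwards. *)
Lemma sum_porbit_tuples p U c (F : {set T} -> R) : perm_on U p -> (0 < c)%N ->
  \sum_(u in U | #|porbit p u| == c) F (porbit p u) =
  \sum_(t : c.-tuple T | [&& uniq t, [set u in t] \subset U & fcycle p t])
     F [set u in t].
Proof.
move=> pU; case: c => // c _.
pose d u : c.+1.-tuple T := insubd (nseq_tuple c.+1 u) (fingraph.orbit p u).
have dE u : #|porbit p u| = c.+1 -> d u = fingraph.orbit p u :> seq T.
  by move=> uc; rewrite val_insubd size_orbit order_porbit uc eqxx.
have set_d u : #|porbit p u| = c.+1 -> porbit p u = [set v in d u].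
  by move=> uc; apply/setP => v; rewrite porbit_orbit !inE -dE.
have thead_d u : thead (d u) = u.
  rewrite /thead (tnth_nth u) /d val_insubd; case: ifP => // _.
  by rewrite /fingraph.orbit -orderSpred.
have orbit_thead (t : c.+1.-tuple T) : uniq t -> fcycle p t -> fingraph.orbit p (thead t) = t :> seq T.
  case: t => -[|u s] // st ut ct; rewrite /thead (tnth_nth u) /=.
  by rewrite (fingraph.orbitE ct ut (mem_head u s)) /= eqxx rot0.
rewrite [RHS](reindex_onto d (fun t => thead t)) /=; last first.
  move=> t /and3P[ut _ ct]; apply: val_inj; rewrite /= dE ?orbit_thead //.
  by rewrite -order_porbit -size_orbit orbit_thead // size_tuple.
apply: eq_big => [u|u /andP[uU /eqP uc]]; last first.
  by congr F; rewrite set_d.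
rewrite thead_d eqxx andbT; apply/andP/and3P => [[uU /eqP uc]|[ut tU ct]].
  have pUU : {in U, forall v, p v \in U} by move=> v vU; rewrite perm_closed.
  rewrite dE // -set_d // porbit_closed // orbit_uniq cycle_orbit //.
  exact: perm_inj.
have o := orbit_thead _ ut ct; rewrite thead_d in o.
have uc : #|porbit p u| = c.+1 by rewrite -order_porbit -size_orbit o size_tuple.
rewrite uc eqxx; split=> //; apply: (subsetP tU); rewrite inE.
by have := fingraph.in_orbit p u; rewrite o.
Qed.

Lemma porbit_ext p r V u : {in V, p =1 r} -> {in V, forall v, r v \in V} ->
  u \in V -> porbit p u = porbit r u.
Proof.
move=> pr rV uV; have e i : (p ^+ i)%g u = (r ^+ i)%g u /\ (r ^+ i)%g u \in V.
  elim: i => [|i [IH1 IH2]]; first by rewrite !expg0 perm1.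
  by rewrite !expgSr !permM IH1 pr // rV.
apply/setP => v; apply/porbitP/porbitP => -[i ->]; exists i; first by have [] := e i.
by have [] := e i.
Qed.

Lemma marked_ext cs V p r : {in V, p =1 r} -> {in V, forall v, r v \in V} ->
  marked cs V p = marked cs V r.
Proof.
elim: cs V => //= c cs IH V pr rV.
apply: eq_big => [u|u /andP[uV _]].
  by case: (boolP (u \in V)) => //= uV; rewrite (porbit_ext pr rV uV).
rewrite (porbit_ext pr rV uV); apply: IH => v; rewrite inE => /andP[vu vV].
  exact: pr.
rewrite inE rV // andbT; apply: contra vu.
by rewrite -!eq_porbit_mem porbit_next.
Qed.

(** Dividing by the rotation k of t turns a permutation having t as a cycle into one that fixes t
    pointwise. *)
Lemma sum_perm_fcycle (t : seq T) U (F : {perm T} -> R) (k : {perm T}) :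
    uniq t -> [set u in t] \subset U -> (forall u, k u = next t u) ->
  \sum_(p | perm_on U p && fcycle p t) F p =
  \sum_(r | perm_on (U :\: [set u in t]) r) F (k * r)%g.
Proof.
move=> ut tU kE; have next_id u : u \notin t -> next t u = u.
  by rewrite next_nth => /negPf->.
rewrite (reindex_inj (mulgI k)) /=; apply: eq_bigl => r.
apply/andP/idP => [[pU ct]|rU].
  apply/subsetP => u; rewrite !inE => ru.
  have ut' : u \notin t.
    apply: contra ru => ut'; rewrite -mem_prev in ut'.
    have := next_cycle ct ut' => /= /eqP; rewrite permM kE.
    by rewrite next_prev // => ->.
  rewrite ut' /=; apply: contraNT ru => /(out_perm pU).
  by rewrite permM kE next_id // => ->.
have rt u : u \in t -> r u = u by move=> u_t; apply: (out_perm rU); rewrite !inE u_t.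
split.
  apply/subsetP => u; rewrite inE permM kE; apply: contraNT => uU.
  have u_t : u \notin t by apply: contra uU => u_t; apply: (subsetP tU); rewrite inE.
  by rewrite next_id // (out_perm rU) // !inE negb_and uU orbT.
have := cycle_next ut; apply: (@sub_in_cycle _ (mem t) (frel (next t)) _ _ t).
  move=> u v /= u_t v_t /eqP <-.
  by rewrite permM kE rt // mem_next.
exact/allP.
Qed.

Section OneCycle.
Context (t : seq T) (U : {set T}) (p r : {perm T}).
Context (ut : uniq t) (t2 : (1 < size t)%N) (tU : [set u in t] \subset U).
Context (ct : fcycle p t) (pr : {in U :\: [set u in t], p =1 r}).
Context (rU : {in U :\: [set u in t], forall u, r u \in U :\: [set u in t]}).
Let V := U :\: [set u in t].

Lemma fcycle_mem u : u \in t -> p u \in t.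
Proof. by move=> u_t; have /eqP -> := next_cycle ct u_t; rewrite mem_next. Qed.

Lemma fcycle_move u : u \in t -> p u != u.
Proof.
move=> u_t; apply/eqP => pu; have := porbit_fcycle ct u_t => /(congr1 (fun A => #|pred_of_set A|)).
rewrite cardsE (card_uniqP ut) => E; move: t2; rewrite -E ltnNge => /negP; apply.
rewrite -(cards1 u); apply/subset_leq_card/subsetP => v /porbitP[i ->].
by rewrite inE permX; elim: i => //= i /eqP->; rewrite pu.
Qed.

Lemma acyclic_split (E J : {set T}) : E \subset [set u in t] -> J \subset V ->
  acyclic p (E :|: J) = (E != [set u in t]) && acyclic r J.
Proof.
move=> Et JV; have JVt u : u \in J -> u \notin t.
  by move=> /(subsetP JV); rewrite !inE => /andP[].
apply/acyclicP/andP => [h|[Ent /acyclicP h]].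
  split.
    apply/eqP => EA; have := ltnW t2; rewrite -has_predT => /hasP[u u_t _].
    have uE : u \in E by rewrite EA inE.
    have [||v] := h u; rewrite ?inE ?uE ?fcycle_move //.
    by rewrite (porbit_fcycle ct u_t) EA !inE => ->.
  apply/acyclicP => u uJ ru; have uV := subsetP JV _ uJ.
  have [||v] := h u; rewrite ?inE ?uJ ?orbT ?pr //.
  rewrite (porbit_ext pr rU uV) => vu; rewrite negb_or => /andP[_ vJ].
  by exists v.
move=> u; rewrite inE => /orP[uE _|uJ].
  have u_t : u \in t by have := subsetP Et _ uE; rewrite inE.
  have : E \proper [set u in t] by rewrite properEneq Ent.
  case/properP => _ [v vt vE]; exists v; first by rewrite (porbit_fcycle ct u_t).
  rewrite inE negb_or vE; apply/negP => /JVt.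
  by rewrite inE in vt; rewrite vt.
have uV := subsetP JV _ uJ; rewrite pr // => ru.
have [v vu vJ] := h u uJ ru; exists v; first by rewrite (porbit_ext pr rU uV).
rewrite inE negb_or vJ andbT; apply/negP => /(subsetP Et).
rewrite inE => vt; move: vu; rewrite -(porbit_ext pr rU uV) porbit_sym.
by rewrite (porbit_fcycle ct vt) inE (negPf (JVt _ uJ)).
Qed.

Lemma weight_split (E J : {set T}) : E \subset [set u in t] -> J \subset V ->
  weight p (E :|: J) U =
  \prod_(u <- t) arc_weight y z (u \in E) (p u \in E) * weight r J V.
Proof.
move=> Et JV; have JVt u : u \in J -> u \notin t.
  by move=> /(subsetP JV); rewrite !inE => /andP[].
have tJ u : u \in t -> (u \in J) = false.
  by move=> ut'; apply/negP => /JVt; rewrite ut'.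
have VE u : u \in V -> (u \in E) = false.
  rewrite !inE => /andP[u_t _]; apply/negP => /(subsetP Et).
  by rewrite inE (negPf u_t).
rewrite /weight (big_setID [set u in t]) /= (setIidPr tU); congr (_ * _).
  rewrite [RHS]big_uniq //=; apply: eq_big => [u|u]; rewrite inE // => u_t.
  rewrite /vertex_weight !inE !tJ ?fcycle_mem // !orbF.
  by rewrite (negPf (fcycle_move u_t)) andbF mulr1.
apply: eq_bigr => u uV; rewrite /vertex_weight !inE pr // !VE //.
exact: rU.
Qed.

End OneCycle.

(** Once t is a cycle, weight and acyclicity split into a part on t and a part off t, and the proper
    subsets of t sum to [cycle_weight]. Length 1 is different: a fixed point may lie in I and then
    carries the factor x. *)
Lemma peel_tuple cs (t : seq T) U : uniq t -> (1 < size t)%N ->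
    [set u in t] \subset U ->
  \sum_(p | perm_on U p && fcycle p t)
     \sum_(I : {set T} | (I \subset U) && acyclic p I)
       (marked cs (U :\: [set u in t]) p)%:R * weight p I U =
  cycle_weight y z (size t) * marked_sum cs (U :\: [set u in t]).
Proof.
move=> ut t2 tU; set V := U :\: _.
pose k := perm (can_inj (prev_next ut)).
have kE u : k u = next t u by rewrite permE.
rewrite (sum_perm_fcycle _ ut tU kE) mulr_sumr; apply: eq_bigr => r rV.
have rt u : u \in t -> r u = u by move=> u_t; apply: (out_perm rV); rewrite !inE u_t.
have pr : {in V, (k * r)%g =1 r}.
  move=> u; rewrite !inE => /andP[u_t _].
  by rewrite permM kE next_nth (negPf u_t).
have rVV : {in V, forall u, r u \in V} by move=> u uV; rewrite perm_closed.
have ct : fcycle (k * r)%g t.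
  have := cycle_next ut; apply: (@sub_in_cycle _ (mem t) (frel (next t)) _ _ t).
    move=> u v /= u_t v_t /eqP <-.
    by rewrite permM kE rt // mem_next.
  exact/allP.
rewrite (marked_ext _ pr rVV) -!mulr_sumr.
rewrite mulrCA; congr (_ * _).
rewrite big_mkcondr (sum_subsets _ tU).
rewrite -(@sum_cycle_weight _ _ y z (k * r)%g t) // ?(ltnW t2) //.
rewrite [in RHS]big_mkcondr big_mkcondr mulr_suml; apply: eq_bigr => E Et.
rewrite [in RHS]mulr_sumr; apply: eq_bigr => J JV.
rewrite (acyclic_split ut t2 ct pr rVV Et JV) (weight_split ut t2 tU ct pr rVV Et JV).
by case: (E != _); case: (acyclic r J); rewrite ?mul0r ?mulr0.
Qed.

Theorem marked_sum_cons c cs U : (1 < c)%N ->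
  marked_sum (c :: cs) U = cycle_weight y z c * iter c dropsum (marked_sum cs) U.
Proof.
move=> c2; rewrite -iter_dropsumZ -sum_uniq_tuples.
have e (t : c.-tuple T) : uniq t && ([set u in t] \subset U) ->
    cycle_weight y z c * marked_sum cs (U :\: [set u in t]) =
    \sum_(p | perm_on U p && fcycle p t)
      \sum_(I : {set T} | (I \subset U) && acyclic p I)
       (marked cs (U :\: [set u in t]) p)%:R * weight p I U.
  by case/andP=> ut tU; rewrite peel_tuple ?size_tuple.
rewrite (eq_bigr _ e).
rewrite (exchange_big_dep (perm_on U)) /=; last by move=> t p _ /andP[].
apply: eq_bigr => p pU; rewrite exchange_big /=; apply: eq_bigr => I _.
rewrite natr_sum mulr_suml.
rewrite (sum_porbit_tuples (fun A => (marked cs (U :\: A) p)%:R * weight p I U) pU).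
  by apply: eq_bigl => t; rewrite pU andbA.
exact: ltnW.
Qed.

(** The second factor depends on cs only through its sum, so it is common to all terms of the Hankel
    determinant. *)
Theorem marked_sum_cycles cs U : all (fun c => 1 < c)%N cs ->
  marked_sum cs U = \prod_(c <- cs) cycle_weight y z c
                 * iter (sumn cs) dropsum (marked_sum [::]) U.
Proof.
elim: cs U => [|c cs IH] U /=; first by rewrite big_nil mul1r.
case/andP=> c2 /IH {}IH; rewrite marked_sum_cons // big_cons -mulrA; congr (_ * _).
rewrite (eq_iter_dropsum _ _ IH) iter_dropsumZ iterD //.
Qed.
End Peel.

(** The coefficients of the linear recurrence form a kernel vector with last entry 1; multiplying by
    the adjugate isolates the determinant, over any commutative ring. *)
Lemma cycle_weight_hankel (R : comNzRingType) (y z : R) (s : nat) : (0 < s)%N ->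
  \det (\matrix_(i < 4, j < 4) cycle_weight y z (s + i + j)) = 0.
Proof.
move=> s0; set H := \matrix_(i, j) _.
pose v : 'cV[R]_4 := \col_j [:: z - y; 1 + y *+ 2 - z; - (y + 2); 1]`_j.
have Hv : H *m v = 0.
  apply/matrixP => i k; rewrite !mxE !big_ord_recl big_ord0 !mxE /= addr0.
  rewrite /bump /= !add1n addn0 (@cycle_weight_rec _ y z (s + i)) ?addn_gt0 ?s0 //.
  ring.
have : \adj H *m (H *m v) = 0 by rewrite Hv mulmx0.
rewrite mulmxA mul_adj_mx mul_scalar_mx => /matrixP/(_ ord_max ord0).
by rewrite !mxE /= mulr1.
Qed.

(** * Marked cycles as products of falling factorials *)

Fixpoint fall (m : nat -> rat) (cs : seq nat) : rat :=
  if cs is c :: cs' then c%:R * m c * fall (fun k => m k - (k == c)%:R) cs' else 1.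

Lemma eq_fall m m' cs : m =1 m' -> fall m cs = fall m' cs.
Proof.
elim: cs m m' => //= c cs IH m m' e; rewrite e; congr (_ * _).
by apply: IH => k; rewrite e.
Qed.

Section Marked.
Context (T : finType).
Implicit Types (p : {perm T}) (V : {set T}).

Definition orbits_of_size p V c := #|[set C in porbits p | (C \subset V) && (#|C| == c)]|.

Lemma mem_porbits p u : porbit p u \in porbits p.
Proof. by apply/imsetP; exists u. Qed.

Lemma porbit_disjoint p u v :
  [disjoint porbit p v & porbit p u] = (porbit p v != porbit p u).
Proof.
apply/idP/idP => [/pred0P h|vu].
  by apply/eqP => vu; have := h v; rewrite /= -vu porbit_id.
apply/pred0P => w /=; apply/negP => /andP[]; rewrite -!eq_porbit_mem => /eqP e1 /eqP e2.
by rewrite -e1 e2 eqxx in vu.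
Qed.

Lemma card_orbits_of_size p V c : {in V, forall v, p v \in V} ->
  #|[set u in V | #|porbit p u| == c]| = (c * orbits_of_size p V c)%N.
Proof.
move=> pV; rewrite -sum1_card mulnC /orbits_of_size -sum_nat_const.
rewrite (partition_big (porbit p) (mem [set C in porbits p | (C \subset V) && (#|C| == c)])) /=.
  apply: eq_bigr => C; rewrite inE => /and3P[/imsetP[u _ ->] CV /eqP <-].
  rewrite -sum1_card; apply: eq_bigl => v; rewrite inE eq_porbit_mem.
  case: (boolP (v \in porbit p u)) => vu; rewrite ?andbF //.
  have -> : porbit p v = porbit p u by apply/eqP; rewrite eq_porbit_mem.
  by rewrite (subsetP CV) // sum1_card eqxx.
move=> u; rewrite !inE => /andP[uV ->]; by rewrite porbit_closed // mem_porbits.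
Qed.

(** There are c m_c points on c-cycles, and deleting the cycle of the chosen point lowers m_c by 1
    and no other count. *)
Lemma marked_fall p cs V : {in V, forall v, p v \in V} ->
  (marked cs V p)%:R = fall (fun c => (orbits_of_size p V c)%:R) cs.
Proof.
elim: cs V => //= c cs IH V pV; rewrite natr_sum.
set g := fall _ _.
transitivity (\sum_(u in [set u in V | #|porbit p u| == c]) g).
  apply: eq_big => [u|u /andP[uV /eqP uc]]; first by rewrite inE.
  rewrite IH => [|v]; last first.
    rewrite !inE => /andP[vu vV]; rewrite pV // andbT; apply: contra vu.
    by rewrite -!eq_porbit_mem porbit_next.
  apply: eq_fall => k; apply/eqP; rewrite eq_sym subr_eq -natrD eqr_nat; apply/eqP.
  have [<-|kc] := eqVneq c k.
    rewrite addn1 /orbits_of_size (cardsD1 (porbit p u)) !inE.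
    rewrite porbit_closed // uc eqxx mem_porbits //= add1n; congr S.
    apply: eq_card => C; rewrite !inE; case: (boolP (C \in porbits p)); rewrite ?andbF //=.
    move=> /imsetP[v _ ->]; rewrite subsetD; case: (_ == c); rewrite ?andbF // !andbT.
    by rewrite porbit_disjoint andbC.
  rewrite addn0; apply: eq_card => C; rewrite !inE subsetD.
  case: (boolP (C \in porbits p)) => //= /imsetP[v _ ->].
  case: (boolP (#|porbit p v| == k)); rewrite ?andbF // !andbT => /eqP vk.
  rewrite porbit_disjoint; have -> : porbit p v != porbit p u; last by rewrite andbT.
  by apply: contraNneq kc => e; rewrite -uc -vk e.
rewrite sumr_const card_orbits_of_size // -[g *+ _]mulr_natl natrM.
by rewrite -[_ * g]/(_ * _) /g; congr (_ * _).
Qed.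
End Marked.

(** * The Hankel determinant *)

Lemma prod_if_const (R : comNzRingType) (T : finType) (P : pred T) (x : R) :
  \prod_u (if P u then x else 1) = x ^+ #|[set u | P u]|.
Proof. by rewrite -big_mkcond prodr_const cardsE. Qed.

Lemma weight_monomial (R : comNzRingType) (T : finType) (x y z : R)
    (p : {perm T}) (I : {set T}) :
  weight x y z p I [set: T] =
  x ^+ fixed p I [set: T] * y ^+ singles p I [set: T] * z ^+ finals p I [set: T].
Proof.
rewrite /weight (eq_bigl xpredT) => [|u]; last by rewrite inE.
rewrite big_split /= mulrC -mulrA; congr (_ * _).
  rewrite prod_if_const; congr (_ ^+ _).
  by apply: eq_card => u; rewrite !inE.
transitivity (\prod_u ((if (u \notin I) && ((p^-1)%g u \notin I) then y else 1)
    * (if (u \notin I) && ((p^-1)%g u \in I) then z else 1))).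
  (* Each arc weight is charged to the image point, where [singles] and [finals] are read off. *)
  rewrite [RHS](reindex_inj (@perm_inj _ p)) /=; apply: eq_bigr => u _.
  rewrite permK /arc_weight.
  by case: (p u \in I); case: (u \in I); rewrite ?mulr1 ?mul1r.
rewrite big_split /= !prod_if_const.
by congr (_ ^+ _ * _ ^+ _); apply: eq_card => u; rewrite !inE.
Qed.

(** Apply the linear map that sends X^e to g e. *)
Lemma sum_monomials_eq0 (J : finType) (P : pred J) (a : J -> rat) (c : J -> nat) :
    \sum_(j | P j) a j *: 'X^(c j) = 0 :> {poly rat} ->
  forall g : nat -> rat, \sum_(j | P j) a j * g (c j) = 0.
Proof.
move=> S0 g; pose B := (\max_j c j).+1.
transitivity (\sum_(j | P j) \sum_(e < B) a j * (c j == e)%:R * g e).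
  apply: eq_bigr => j _; have cB : (c j < B)%N by rewrite ltnS leq_bigmax.
  rewrite (bigD1 (Ordinal cB)) //= eqxx mulr1 big1 ?addr0 // => e ne.
  have -> : (c j == e) = false by apply: contraNF ne => /eqP ce; apply/eqP/val_inj.
  by rewrite mulr0 mul0r.
rewrite exchange_big big1 //= => e _; rewrite -mulr_suml.
have := congr1 (fun q : {poly rat} => q`_e) S0; rewrite coef_sum coef0.
by under eq_bigr do rewrite coefZ coefXn eq_sym; move=> ->; rewrite mul0r.
Qed.

(** The cycle lengths in the term of t of the Leibniz expansion. *)
Definition marks s (t : 'S_4) := [seq (s + i + t i)%N | i : 'I_4].

Lemma sumn_marks s (t : 'S_4) : sumn (marks s t) = (4 * s + 12)%N.
Proof.
rewrite /marks sumnE big_map big_enum /= big_split /= big_split /=.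
have -> : (\sum_(i < 4) t i = \sum_(i < 4) i)%N.
  by rewrite [RHS](reindex_inj (@perm_inj _ t)).
rewrite sum_nat_const card_ord !big_ord_recl big_ord0 /=.
by rewrite /bump /=; lia.
Qed.

(** This recovers the size of I from the exponents of y and z. *)
Lemma card_compl_split n (p : 'S_n) (I : {set 'I_n}) :
  (singles p I [set: 'I_n] + finals p I [set: 'I_n] + #|I|)%N = n.
Proof.
rewrite -[RHS](card_ord n) -(cardsC I) addnC; congr addn.
rewrite -(cardsID (img p I) (~: I)) addnC.
congr (_ + _)%N; first by apply: eq_card => u; rewrite !inE.
by apply: eq_card => u; rewrite !inE; case: (u \in I); rewrite ?andbF ?andbT.
Qed.

Lemma porbit_conj n (p t : 'S_n) u : porbit (p ^ t)%g (t u) = t @: porbit p u.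
Proof.
apply/setP => v; apply/porbitP/imsetP => [[i ->]|[w /porbitP[i ->] ->]].
  by exists ((p ^+ i)%g u); rewrite ?mem_porbit // -conjXg permJ.
by exists i; rewrite -conjXg permJ.
Qed.

Lemma orbits_of_size_conj n (p t : 'S_n) c :
  orbits_of_size (p ^ t)%g [set: 'I_n] c = orbits_of_size p [set: 'I_n] c.
Proof.
rewrite /orbits_of_size -[RHS](card_imset _ (imset_inj (@perm_inj _ t))).
apply: eq_card => C; apply/idP/imsetP.
  rewrite inE subsetT => /andP[/imsetP[u _ ->] /=].
  rewrite -(permKV t u) porbit_conj card_imset; last exact: perm_inj.
  by move=> h; exists (porbit p ((t^-1)%g u)); rewrite // inE subsetT mem_porbits.
case=> D; rewrite inE subsetT /= => /andP[/imsetP[u _ ->] h] ->.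
rewrite inE subsetT /= card_imset ?h ?andbT; last exact: perm_inj.
by rewrite -porbit_conj mem_porbits.
Qed.

(** * Vanishing of the pairing with increasing patterns *)

Section Vanishing.
Context (n s : nat) (s2 : (1 < s)%N).
Implicit Types (p : 'S_n) (I : {set 'I_n}).

Definition hankel_mark p : rat :=
  \sum_(t : 'S_4) (-1) ^+ t * (marked (marks s t) [set: 'I_n] p)%:R.

(** All [marks s t] have the same sum, so the iterated [dropsum] factors out and leaves the Hankel
    determinant of the cycle weights. *)
Lemma sum_hankel_mark_weight (R : comNzRingType) (x y z : R) (f : {rmorphism rat -> R}) :
  \sum_(p : 'S_n) \sum_(I : {set 'I_n} | acyclic p I)
     f (hankel_mark p) * weight x y z p I [set: 'I_n] = 0.
Proof.
transitivity (\sum_(t : 'S_4) (-1) ^+ t * marked_sum x y z (marks s t) [set: 'I_n]).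
  rewrite /marked_sum; under [RHS]eq_bigr do rewrite mulr_sumr.
  rewrite exchange_big /=; apply: eq_big => [p|p _].
    by apply/esym/subsetP => u _; rewrite inE.
  under [RHS]eq_bigr do rewrite mulr_sumr.
  rewrite exchange_big /=; apply: eq_big => [I|I _]; first by rewrite subsetT.
  rewrite /hankel_mark rmorph_sum mulr_suml; apply: eq_bigr => t _.
  by rewrite rmorphM rmorph_sign rmorph_nat mulrA.
have tE t : marked_sum x y z (marks s t) [set: 'I_n] =
    \prod_(i < 4) cycle_weight y z (s + i + t i)
      * iter (4 * s + 12) (@dropsum _ _) (marked_sum x y z [::]) [set: 'I_n].
  rewrite marked_sum_cycles ?sumn_marks; last first.
    by apply/allP => c /mapP[i _ ->]; lia.
  by rewrite /marks big_map big_enum.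
under eq_bigr do rewrite tE mulrA; rewrite -mulr_suml.
have := cycle_weight_hankel y z (ltnW s2); rewrite /determinant.
under eq_bigr => t _ do under eq_bigr do rewrite mxE.
by move=> ->; rewrite mul0r.
Qed.

(* The three exponents are encoded in base n + 1 as one exponent, so that a sum
   of univariate monomials suffices. *)
Theorem hankel_mark_queue k :
  \sum_(p : 'S_n) \sum_(I : {set 'I_n} | #|I| == k)
     hankel_mark p * (queue_count p I [set: 'I_n] [::])%:R = 0.
Proof.
pose N := n.+1.
pose g e : rat := if (n - (e %/ N) %% N - e %/ N ^ 2 == k)%N
  then (queue_val n ((e %/ N) %% N) (e %/ N ^ 2) (e %% N) 0)%:~R else 0.
pose code p I := (fixed p I [set: 'I_n] + N * singles p I [set: 'I_n]
   + N ^ 2 * finals p I [set: 'I_n])%N.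
have /sum_monomials_eq0/(_ g) : \sum_(pI : 'S_n * {set 'I_n} | acyclic pI.1 pI.2)
   hankel_mark pI.1 *: 'X^(code pI.1 pI.2) = 0 :> {poly rat}.
  have := @sum_hankel_mark_weight {poly rat} 'X 'X^N 'X^(N ^ 2) polyC.
  rewrite pair_big_dep /= => h; rewrite -[RHS]h; apply: eq_bigr => -[p I] /= _.
  rewrite mul_polyC weight_monomial /code -!exprM !exprD.
  by [].
rewrite -(pair_big_dep xpredT (fun p I => acyclic p I)
   (fun p I => hankel_mark p * g (code p I))) /= => S0.
rewrite -[RHS]S0; apply: eq_bigr => p _.
rewrite big_mkcond [RHS]big_mkcond /=; apply: eq_bigr => I _.
case: (boolP (acyclic p I)) => [ac|/queue_count_cyclic->]; last by rewrite mulr0 if_same.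
have b_small : (fixed p I [set: 'I_n] < N)%N.
  by rewrite ltnS -[X in (_ <= X)%N](card_ord n) max_card.
have u_small : (singles p I [set: 'I_n] < N)%N.
  by rewrite ltnS -[X in (_ <= X)%N](card_ord n) max_card.
have e0 : (code p I %% N = fixed p I [set: 'I_n])%N.
  by rewrite /code -mulnn -mulnA -addnA -mulnDr mulnC addnC modnMDl modn_small.
have e1 : (code p I %/ N = singles p I [set: 'I_n] + N * finals p I [set: 'I_n])%N.
  by rewrite /code -mulnn -mulnA -addnA -mulnDr mulnC addnC divnMDl // divn_small ?addn0.
have e2 : ((code p I %/ N) %% N = singles p I [set: 'I_n])%N.
  by rewrite e1 mulnC addnC modnMDl modn_small.
have e3 : (code p I %/ N ^ 2 = finals p I [set: 'I_n])%N.
  by rewrite -mulnn divnMA e1 mulnC addnC divnMDl // divn_small ?addn0.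
rewrite /g e0 e2 e3.
have -> : (n - singles p I [set: 'I_n] - finals p I [set: 'I_n])%N = #|I|.
  by rewrite -{1}(card_compl_split p I); lia.
case: eqP => _; last by rewrite mulr0.
congr (_ * _); rewrite pmulrn queue_count_full // /queue_formula cardsT card_ord.
by [].
Qed.

Lemma hankel_mark_conj (p t : 'S_n) : hankel_mark (p ^ t)%g = hankel_mark p.
Proof.
apply: eq_bigr => u _; rewrite !marked_fall; try by move=> *; rewrite inE.
by congr (_ * _); apply: eq_fall => c; rewrite orbits_of_size_conj.
Qed.

(** As [hankel_mark] is a class function, n! times the sum is the sum over all conjugates, to which
    [sum_Nid_conj] applies. *)
Theorem hankel_mark_Nid k : \sum_(p : 'S_n) hankel_mark p * (Nid k p)%:R = 0.
Proof.
have n0 : (#|'S_n|%:R : rat) != 0.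
  by rewrite pnatr_eq0 -lt0n; apply/card_gt0P; exists 1%g.
apply: (mulfI n0); rewrite mulr0 mulr_natl -sumr_const.
transitivity (\sum_(t : 'S_n) \sum_(p : 'S_n) hankel_mark p * (Nid k (p ^ t)%g)%:R).
  apply: eq_big => [t|t _]; first by rewrite inE.
  rewrite (reindex_inj (@conjg_inj _ t)) /=.
  by apply: eq_bigr => p _; rewrite hankel_mark_conj.
rewrite exchange_big -[RHS](hankel_mark_queue k); apply: eq_bigr => p _ /=.
by rewrite -mulr_sumr -natr_sum sum_Nid_conj natr_sum mulr_sumr.
Qed.
End Vanishing.

(** * The determinant as a polynomial in the cycle counts *)

Section MonomialEvaluation.
Context (a : nat -> rat).

Definition mon_eval (m : {cmonom nat}) : rat := \prod_(i <- finsupp m) a i ^+ m i.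

Lemma mon_evalEw (m : {cmonom nat}) (d : {fset nat}) : (finsupp m `<=` d)%fset ->
  mon_eval m = \prod_(i <- d) a i ^+ m i.
Proof.
move=> le; rewrite /mon_eval (big_fset_incl _ le) // => i _.
by rewrite -cmE_neq0 negbK => /eqP->.
Qed.

Lemma mon_eval_mmorphism : mmorphism mon_eval.
Proof.
split=> [m1 m2|]; last by rewrite /mon_eval mdom1 big_seq_fset0.
rewrite (mon_evalEw (fsubsetUl (finsupp m1) (finsupp m2))).
rewrite (mon_evalEw (fsubsetUr (finsupp m1) (finsupp m2))).
rewrite /mon_eval mdomD -big_split /=; apply: eq_bigr => i _.
by rewrite cmM exprD.
Qed.

HB.instance Definition _ := isMultiplicative.Build {cmonom nat} rat mon_eval
  mon_eval_mmorphism.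

Definition poly_eval (f : cycle_poly) : rat := mmap idfun mon_eval f.

HB.instance Definition _ := GRing.RMorphism.copy poly_eval (mmap idfun mon_eval).

Lemma poly_evalZ c f : poly_eval (c *: f) = c * poly_eval f.
Proof. exact: mmapZ. Qed.

Definition cycle_var (c : nat) : cycle_poly := << ucm c.-1 >>.

Lemma poly_eval_var c : poly_eval (cycle_var c) = a c.-1.
Proof.
by rewrite /poly_eval mmapU /= mul1r /mon_eval mdomU big_seq_fset1 cmUU expr1.
Qed.
End MonomialEvaluation.

(** The list [used] holds the lengths already consumed; their multiplicities are the shifts of the
    falling factorials. *)
Fixpoint fall_poly (used cs : seq nat) : cycle_poly :=
  if cs is c :: cs' then
    c%:R *: ((cycle_var c - (count_mem c used)%:R) * fall_poly (c :: used) cs')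
  else 1.

Lemma eval_fall_poly a used cs :
  poly_eval a (fall_poly used cs) =
  fall (fun c => a c.-1 - (count_mem c used)%:R) cs.
Proof.
elim: cs used => [|c cs IH] used /=; first exact: rmorph1.
rewrite poly_evalZ rmorphM rmorphB rmorph_nat /=.
rewrite poly_eval_var IH mulrA.
by congr (_ * _); apply: eq_fall => k; rewrite eq_sym natrD opprD addrA addrAC.
Qed.

Lemma eq_in_fall (m m' : nat -> rat) cs : {in cs, m =1 m'} -> fall m cs = fall m' cs.
Proof.
elim: cs m m' => //= c cs IH m m' e; rewrite e ?mem_head //; congr (_ * _).
by apply: IH => k kcs; rewrite e // inE kcs orbT.
Qed.

Definition hankel_poly (s : nat) : cycle_poly :=
  \sum_(t : 'S_4) (-1) ^+ t *: fall_poly [::] (marks s t).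

Lemma marks_gt0 s t c : (0 < s)%N -> c \in marks s t -> (0 < c)%N.
Proof. by move=> s0 /mapP[i _ ->]; rewrite -addnA addn_gt0 s0. Qed.

Lemma hankel_poly_eval s a : poly_eval a (hankel_poly s) =
  \sum_(t : 'S_4) (-1) ^+ t * fall (fun c => a c.-1) (marks s t).
Proof.
rewrite rmorph_sum; apply: eq_bigr => t _; rewrite [LHS]poly_evalZ eval_fall_poly.
by congr (_ * _); apply: eq_fall => c; rewrite subr0.
Qed.

Lemma cycle_eval_hankel n s (p : 'S_n) : (0 < s)%N ->
  cycle_eval (hankel_poly s) p = hankel_mark s p.
Proof.
move=> s0; rewrite -[LHS]/(poly_eval (fun i => (ncycles p i.+1)%:R) (hankel_poly s)).
rewrite hankel_poly_eval; apply: eq_bigr => t _; congr (_ * _).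
rewrite marked_fall; last by move=> *; rewrite inE.
apply: eq_in_fall => c /(marks_gt0 s0) c0; rewrite prednK //; congr _%:R.
by apply: eq_card => C; rewrite !inE subsetT.
Qed.

Lemma E_hankel_poly s n k : (1 < s)%N -> E (hankel_poly s) n k = 0.
Proof.
move=> s2; rewrite /E; under eq_bigr do rewrite cycle_eval_hankel ?(ltnW s2) //.
by rewrite hankel_mark_Nid // mulr0.
Qed.

Lemma fall_eq0 (m : nat -> rat) cs c : c \in cs -> m c = 0 -> fall m cs = 0.
Proof.
elim: cs m => //= d cs IH m; rewrite inE; case: eqVneq => [->|cd] /= cs0 m0.
  by rewrite m0 mulr0 mul0r.
by rewrite IH ?mulr0 // m0 (negPf cd) subr0.
Qed.

(* At m_(s+3) = 4 and m_c = 0 otherwise only the antidiagonal of the Hankel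
   determinant survives. *)
Lemma hankel_poly_neq0 s : hankel_poly s <> 0.
Proof.
pose a i : rat := if i == (s + 3).-1 then 4 else 0.
move=> /(congr1 (poly_eval a)); rewrite rmorph0 hankel_poly_eval.
pose t0 : 'S_4 := perm (@rev_ord_inj 4).
rewrite (bigD1 t0) //= [X in _ + X]big1 => [|t tt0]; last first.
  have [i it] : exists i, t i != rev_ord i.
    apply/existsP; apply: contraNT tt0 => /existsPn h; apply/eqP/permP => i.
    by apply/eqP; rewrite permE -[_ == _]negbK h.
  rewrite (@fall_eq0 _ _ (s + i + t i)%N) ?mulr0 //.
    by apply/mapP; exists i; rewrite ?mem_enum.
  rewrite /a; case: eqP => // e; case/eqP: it; apply: val_inj => /=.
  by move: (ltn_ord i) (ltn_ord (t i)) e; lia.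
rewrite addr0; have -> : marks s t0 = nseq 4 (s + 3).
  transitivity (nseq (size (marks s t0)) (s + 3)%N); last first.
    by rewrite size_map size_enum_ord.
  apply/all_pred1P/allP => c /mapP[i _ ->] /=; rewrite permE /=.
  by apply/eqP; move: (ltn_ord i); lia.
have s0 : (s + 3)%:R != 0 :> rat by rewrite pnatr_eq0 addn_eq0 andbF.
(* What remains is a sign times (s + 3)^4 times the successive factors 4, 3, 2, 1. *)
apply/eqP; rewrite mulf_neq0 ?signr_eq0 //= /a !eqxx.
by rewrite !mulf_neq0.
Qed.

(** * Bounds on the weighted degree *)

Definition wdeg_between (l h : nat) (f : cycle_poly) :=
  forall m, m \in msupp f -> (l <= mon_wdeg m <= h)%N.

Lemma mon_wdegEw (m : {cmonom nat}) (d : {fset nat}) : (finsupp m `<=` d)%fset ->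
  mon_wdeg m = (\sum_(i <- d) m i * i.+1)%N.
Proof.
move=> le; rewrite /mon_wdeg (big_fset_incl _ le) // => i _.
by rewrite -cmE_neq0 negbK => /eqP->.
Qed.

Lemma mon_wdegM (m1 m2 : {cmonom nat}) : mon_wdeg (mmul m1 m2) = (mon_wdeg m1 + mon_wdeg m2)%N.
Proof.
rewrite (mon_wdegEw (fsubsetUl (finsupp m1) (finsupp m2))).
rewrite (mon_wdegEw (fsubsetUr (finsupp m1) (finsupp m2))).
rewrite /mon_wdeg mdomD -big_split /=; apply: eq_bigr => i _.
by rewrite cmM mulnDl.
Qed.

Lemma wdeg_betweenM l1 h1 l2 h2 f g :
  wdeg_between l1 h1 f -> wdeg_between l2 h2 g ->
  wdeg_between (l1 + l2) (h1 + h2) (f * g).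
Proof.
move=> F G m /msuppM_le[m1 [m2 [/F/andP[? ?] /G/andP[? ?] ->]]].
by rewrite mon_wdegM !leq_add.
Qed.

Lemma wdeg_betweenZ l h c f : wdeg_between l h f -> wdeg_between l h (c *: f).
Proof. by move=> F m /(fsubsetP (msuppZ_le _ _))/F. Qed.

Lemma wdeg_betweenB l h f g :
  wdeg_between l h f -> wdeg_between l h g -> wdeg_between l h (f - g).
Proof.
move=> F G m /(fsubsetP (msuppB_le _ _)); rewrite in_fsetU => /orP[]; [exact: F|exact: G].
Qed.

Lemma wdeg_betweenW l h l' h' f : (l' <= l)%N -> (h <= h')%N ->
  wdeg_between l h f -> wdeg_between l' h' f.
Proof.
move=> ll hh F m /F/andP[lm mh].
by rewrite (leq_trans ll lm) (leq_trans mh hh).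
Qed.

Lemma wdeg_between_nat h n : wdeg_between 0 h n%:R.
Proof.
move=> m; rewrite -mpolyC_nat => /(fsubsetP (msuppC_le _)).
by rewrite in_fset1 => /eqP->; rewrite /mon_wdeg mdom1 big_seq_fset0.
Qed.

Lemma wdeg_between_var c : (0 < c)%N -> wdeg_between c c (cycle_var c).
Proof.
move=> c0 m; rewrite msuppU1 in_fset1 => /eqP->.
by rewrite /mon_wdeg mdomU big_seq_fset1 cmUU mul1n prednK // leqnn.
Qed.

Lemma wdeg_between_fall_poly used cs : all (ltn 0) cs ->
  wdeg_between 0 (sumn cs) (fall_poly used cs).
Proof.
elim: cs used => [|c cs IH] used /=; first by move=> _; have := @wdeg_between_nat 0 1; rewrite mulr1n.
case/andP=> c0 /IH {}IH; apply: wdeg_betweenZ.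
apply: (wdeg_betweenM (l1 := 0) (l2 := 0)) (IH _).
apply: wdeg_betweenB; last exact: wdeg_between_nat.
exact: wdeg_betweenW (wdeg_between_var c0).
Qed.

(** The first factor is the unshifted variable m_c, which therefore divides every monomial; this
    lower bound makes the degrees unbounded. *)
Lemma wdeg_between_fall_poly_head c cs : (0 < c)%N -> all (ltn 0) cs ->
  wdeg_between c (c + sumn cs) (fall_poly [::] (c :: cs)).
Proof.
move=> c0 cs0 /=; apply: wdeg_betweenZ; rewrite subr0 -[X in wdeg_between X]addn0.
apply: wdeg_betweenM; [exact: wdeg_between_var|exact: wdeg_between_fall_poly].
Qed.

Lemma wdeg_between_hankel_poly s : (0 < s)%N ->
  wdeg_between s (4 * s + 12) (hankel_poly s).
Proof.
move=> s0; rewrite /hankel_poly.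
elim/big_ind: _ => [m|f g F G m|t _].
- by rewrite msupp0 in_fset0.
- move/(fsubsetP (msuppD_le _ _)); rewrite in_fsetU => /orP[]; [exact: F|exact: G].
apply: wdeg_betweenZ; rewrite -(sumn_marks s t).
have ge_s c : c \in marks s t -> (s <= c)%N.
  by move=> /mapP[i _ ->]; rewrite -addnA leq_addr.
have: size (marks s t) = 4%N by rewrite size_map size_enum_ord.
case: (marks s t) ge_s => [|c cs] ge_s //= _.
have sc : (s <= c)%N by apply: ge_s; rewrite mem_head.
apply: (wdeg_betweenW sc (leqnn _)); apply: wdeg_between_fall_poly_head.
  exact: leq_trans s0 sc.
by apply/allP => d dcs; apply: leq_trans s0 (ge_s _ _); rewrite inE dcs orbT.
Qed.

Lemma leq_wdeg l h f : wdeg_between l h f -> f <> 0 -> (l <= wdeg f)%N.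
Proof.
move=> F f0; have /fset0Pn[m mf] : msupp f != fset0.
  by rewrite msupp_eq0; apply/eqP.
have /andP[lm _] := F m mf.
by apply: leq_trans lm _; rewrite /wdeg; apply: leq_bigmax_seq.
Qed.

Lemma wdeg_leq l h f : wdeg_between l h f -> (wdeg f <= h)%N.
Proof. by move=> F; apply/bigmax_leqP_seq => m /F/andP[]. Qed.

Theorem corollary1p14 :
  (forall D : nat, exists f : cycle_poly,
     [/\ f <> 0, (D <= wdeg f)%N &
         forall n k : nat, (k <= n)%N -> E f n k = 0]) /\
  (exists f : cycle_poly,
     [/\ f <> 0, (wdeg f <= 24)%N &
         forall n k : nat, (k <= n)%N -> E f n k = 0]).
Proof.
split=> [D|].
  (* The index D + 2 exceeds 1, as peeling requires, and bounds the degree from below. *)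
  exists (hankel_poly D.+2); split; first exact: hankel_poly_neq0.
    apply: leq_trans (leq_wdeg (wdeg_between_hankel_poly _) (@hankel_poly_neq0 _)) => //.
    by rewrite leqW.
  by move=> n k _; apply: E_hankel_poly.
(* The least s for which all marked lengths exceed 1; the degree bound is 4 s + 12 = 20. *)
exists (hankel_poly 2); split; first exact: hankel_poly_neq0.
  by apply: leq_trans (wdeg_leq (wdeg_between_hankel_poly _)) _.
by move=> n k _; apply: E_hankel_poly.
Qed.
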